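(* For any integer $k\ge 3$ and constant $0<\eta\le 1$, there exists an $\alpha>0$ such that for all sufficiently large $n\in\mathbb{N}$, any $n$-vertex graph $G$ with $\delta(G)\ge \eta n$ and $\alpha_k(G)\le \alpha n$ contains an $\eta$-quasiperfect $K_k$-tiling, and hence an $\eta$-quasiperfect $F$-tiling for any $k$-vertex graph $F$.
   Context: Graphs are finite and simple; $\delta(G)$ is the minimum degree and $K_k$ the complete graph on $k$ vertices. For $r\in\mathbb{N}$, $\alpha_r(G)$ is the largest size of a set $U\subset V(G)$ such that $G[U]$ contains no copy of $K_r$. An $F$-tiling in $G$ is a collection of vertex-disjoint copies of $F$ in $G$ (not necessarily induced). For $\eta\in(0,1]$ and a $k$-vertex graph $F$, an $F$-tiling in $G$ is $\eta$-quasiperfect if it covers all but at most $\lfloor 1/\eta\rfloor (k-1)$ vertices of $G$. *)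

(* Defs.v *)
From HB Require Import structures.
From mathcomp Require Import all_boot all_order all_algebra.
From mathcomp Require Import reals.

Set Implicit Arguments.
Unset Strict Implicit.
Unset Printing Implicit Defensive.

Import Order.TTheory GRing.Theory Num.Theory.

Record sgraph := SGraph {
  vertex :> finType;
  adj : rel vertex;
  adj_sym : symmetric adj;
  adj_irr : irreflexive adj
}.

Definition complete_adj (k : nat) : rel 'I_k := fun i j => i != j.

Lemma complete_adj_sym k : symmetric (@complete_adj k).
Proof. by move=> i j; rewrite /complete_adj eq_sym. Qed.

Lemma complete_adj_irr k : irreflexive (@complete_adj k).
Proof. by move=> i; rewrite /complete_adj eqxx. Qed.

Definition complete (k : nat) : sgraph :=
  SGraph (@complete_adj_sym k) (@complete_adj_irr k).

Definition induced_adj (G : sgraph) (U : {set G}) : rel {x : G | x \in U} :=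
  fun x y => adj (val x) (val y).

Lemma induced_adj_sym (G : sgraph) (U : {set G}) : symmetric (@induced_adj G U).
Proof. by move=> x y; rewrite /induced_adj adj_sym. Qed.

Lemma induced_adj_irr (G : sgraph) (U : {set G}) :
  irreflexive (@induced_adj G U).
Proof. by move=> x; rewrite /induced_adj adj_irr. Qed.

Definition induced (G : sgraph) (U : {set G}) : sgraph :=
  SGraph (@induced_adj_sym G U) (@induced_adj_irr G U).

Definition degree (G : sgraph) (v : G) : nat := #|[set w : G | adj v w]|.

(* The initial value #|G| exceeds every degree, so it only matters when G has
   no vertex (and then the result is 0). *)
Definition min_degree (G : sgraph) : nat :=
  \big[minn/#|G|]_(v : G) degree v.

(* A (not necessarily induced) copy of F in G is represented by an injective
   edge-preserving map from F to G. *)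
Definition is_copy (F G : sgraph) (f : {ffun F -> G}) : bool :=
  injectiveb f && [forall x, forall y, adj x y ==> adj (f x) (f y)].

Definition contains_copy (F G : sgraph) : bool :=
  [exists f : {ffun F -> G}, is_copy f].

Definition alpha_ (r : nat) (G : sgraph) : nat :=
  \max_(U : {set G} | ~~ contains_copy (complete r) (induced U)) #|U|.

Definition copy_vertices (F G : sgraph) (f : {ffun F -> G}) : {set G} :=
  [set f x | x in F].

(* When F has a vertex, two maps with the same image are not disjoint, so that
   no copy is counted twice. *)
Definition is_tiling (F G : sgraph) (P : {set {ffun F -> G}}) : Prop :=
  (forall f, f \in P -> is_copy f) /\
  (forall f g, f \in P -> g \in P -> f != g ->
     [disjoint copy_vertices f & copy_vertices g]).

Definition covered (F G : sgraph) (P : {set {ffun F -> G}}) : {set G} :=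
  \bigcup_(f in P) copy_vertices f.

Definition has_quasiperfect_tiling (R : realType) (eta : R) (F G : sgraph) :
    Prop :=
  exists P : {set {ffun F -> G}},
    is_tiling P /\
    (#|~: covered P|%:Z <= Num.floor (1 / eta) * (#|F|%:Z - 1))%R.

(* Main.v *)
Require Import Defs.
From HB Require Import structures.
From mathcomp Require Import all_boot all_order all_algebra.
From mathcomp Require Import reals.
From mathcomp Require Import zify ring lra.

Set Implicit Arguments.
Unset Strict Implicit.
Unset Printing Implicit Defensive.

Import Order.TTheory GRing.Theory Num.Theory.

(** The proof is by absorption. Call two vertices linked if their neighbourhoods
    share linearly many vertices: a [K_(k-1)] in the common neighbourhood then
    allows one to exchange them. As [delta >= eta n], at most
    [c = floor (1 / eta)] vertices are pairwise unlinked, and closing the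
    relation under robust two-step paths yields a partition into at most [c]
    large classes within which any two vertices can be exchanged while avoiding
    any small set. Choose a small set [X] that meets every neighbourhood and
    every class in linearly many vertices. For each class, absorbers are
    attached to the edges of a sparse robustly matchable bipartite graph
    (Montgomery), so that any subset of prescribed size of the part of [X] in
    this class can be absorbed. Tile the rest greedily, absorb the at most
    [alpha_k] leftover vertices by cliques through their neighbours in [X],
    shrink the part of [X] in each class by cliques until it exceeds the
    prescribed size by at most [k - 1], and use the absorbers. *)

(** * Finite sets and greedy disjoint choice *)

Lemma subset_of_card (T : finType) (A : {set T}) m :
  m <= #|A| -> exists2 B : {set T}, B \subset A & #|B| = m.
Proof.
elim: m => [|m IHm] mA; first by exists set0; rewrite ?sub0set ?cards0.
have [B sBA Bm] := IHm (ltnW mA).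
have : 0 < #|A :\: B| by rewrite cardsDS // subn_gt0 Bm.
case/card_gt0P=> x; rewrite inE => /andP[xB xA].
exists (x |: B); last by rewrite cardsU1 xB Bm.
by rewrite subUset sub1set xA.
Qed.

Lemma leq_card_bigcup (I T : finType) (P : pred I) (F : I -> {set T}) b :
  (forall i, P i -> #|F i| <= b) -> #|\bigcup_(i | P i) F i| <= #|P| * b.
Proof.
move=> Fb; apply: leq_trans (_ : \sum_(i | P i) b <= _).
  elim/big_rec2: _ => [|i m A Pi IH]; first by rewrite cards0.
  by rewrite (leq_trans (leq_card_setU _ _)) // leq_add ?Fb.
by rewrite sum_nat_const.
Qed.

Lemma disjoint_bigcupr (I T : finType) (P : pred I) (F : I -> {set T})
    (A : {set T}) :
  (forall i, P i -> [disjoint A & F i]) -> [disjoint A & \bigcup_(i | P i) F i].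
Proof.
move=> AF; rewrite -setI_eq0 big_distrr /=; apply/eqP/big1 => i Pi.
by apply/eqP; rewrite setI_eq0 AF.
Qed.

Lemma disjointsP (T : finType) (A B : {set T}) :
  reflect (forall x, x \in A -> x \in B -> False) [disjoint A & B].
Proof.
apply: (iffP idP) => [dAB x xA|dAB]; first by rewrite (disjointFr dAB xA).
by rewrite disjoint_subset; apply/subsetP=> x /dAB xB; apply/negP.
Qed.

Lemma leq_cardsU (T : finType) (A B : {set T}) : #|A :|: B| <= #|A| + #|B|.
Proof. exact: leq_card_setU. Qed.

Lemma cards2_leq (T : finType) (x y : T) : #|[set x; y]| <= 2.
Proof. by rewrite cards2; case: (x != y). Qed.

Lemma disjointsUr (T : finType) (A B C : {set T}) :
  [disjoint A & B :|: C] = [disjoint A & B] && [disjoint A & C].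
Proof. by rewrite -!setI_eq0 setIUr setU_eq0. Qed.

(** The sets are picked one at a time, each avoiding [W0] and those picked before; together these
    never exceed [w] elements. *)
Lemma greedy_disjoint (T : finType) (V : finType) (P : T -> {set V} -> Prop)
    (s w : nat) (W0 : {set V}) :
  (forall t (W : {set V}), #|W| <= w ->
     exists A : {set V}, [/\ [disjoint A & W], #|A| <= s & P t A]) ->
  #|W0| + #|T| * s <= w ->
  exists A : T -> {set V},
    [/\ forall t, P t (A t), forall t, #|A t| <= s,
        forall t, [disjoint A t & W0]
      & forall t t', t != t' -> [disjoint A t & A t']].
Proof.
move=> HP Hw.
suff [A [PA sA WA dA]] : exists A : T -> {set V},
    [/\ {in enum T, forall t, P t (A t)}, {in enum T, forall t, #|A t| <= s},
        {in enum T, forall t, [disjoint A t & W0]}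
      & {in enum T &, forall t t', t != t' -> [disjoint A t & A t']}].
  exists A; split=> [t|t|t|t t'];
    [apply: PA|apply: sA|apply: WA|apply: dA]; exact: mem_enum.
have : size (enum T) <= #|T| by rewrite -cardE.
have : uniq (enum T) by apply: enum_uniq.
elim: (enum T) => [|t l IHl] /=; first by exists (fun _ => set0); split.
case/andP=> tl ul ltl; have [A [PA sA WA dA]] := IHl ul (ltnW ltl).
have [|B [dB sB PB]] := HP t (W0 :|: \bigcup_(u in l) A u).
  apply: leq_trans Hw; apply: leq_trans (leq_card_setU _ _) _.
  rewrite leq_add2l; apply: leq_trans (leq_card_bigcup (b := s) _) _.
    by move=> u ul'; apply: sA.
  by rewrite leq_mul2r (leq_trans (card_size l)) ?(ltnW ltl) ?orbT.
move: dB; rewrite disjointsUr => /andP[dBW dBA].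
have dBu u : u \in l -> [disjoint B & A u].
  by move=> lu; apply: disjointWr dBA; apply: bigcup_sup.
exists (fun u => if u == t then B else A u); split.
- move=> u; rewrite inE; case: eqP => [->|_] //=; exact: PA.
- move=> u; rewrite inE; case: eqP => [->|_] //=; exact: sA.
- move=> u; rewrite inE; case: eqP => [->|_] //=; exact: WA.
- move=> u u'; rewrite !inE.
  case: eqP => [->|_] /=; case: eqP => [->|_] //= uu' vv'; first by rewrite eqxx.
  + by move=> _; apply: dBu.
  + by move=> _; rewrite disjoint_sym; apply: dBu.
  + exact: dA.
Qed.

(** * Robustly matchable bipartite graphs *)

(* Rado's argument: in a minimal family satisfying Hall's condition every set
   is a singleton. *)
Lemma hall (Z B : finType) (e : Z -> {set B}) :
  (forall A : {set Z}, #|A| <= #|\bigcup_(z in A) e z|) ->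
  exists2 h : Z -> B, injective h & forall z, h z \in e z.
Proof.
have [N leN] := ubnP (\sum_z #|e z|).
elim: N e leN => // N IHN e leN Hall.
have e_gt0 z : 0 < #|e z|.
  by have := Hall [set z]; rewrite cards1 big_set1.
have [all1|/forallPn[z0]] := boolP [forall z, #|e z| == 1].
  have /fin_all_exists[h hP] z : exists x, x \in e z.
    by case/card_gt0P: (e_gt0 z) => x; exists x.
  exists h => // z z' hzz'.
  apply/eqP/negPn/negP => zz'.
  have e1 w : e w = [set h w].
    have /cards1P[x ex] := forallP all1 w.
    by have := hP w; rewrite [e w]ex !inE => /eqP->.
  have := Hall [set z; z']; rewrite cards2 zz' bigcup_setU !big_set1 !e1.
  by rewrite hzz' setUid cards1.
move=> ez1; have /card_gt1P[x [y [xz yz xy]]] : 1 < #|e z0|.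
  by rewrite ltn_neqAle eq_sym ez1 e_gt0.
(* One element [b] is removed from [e z0]; if Hall's condition survives for some [b], induction on
   the total size applies. *)
pose del b z := if z == z0 then e z :\ b else e z.
have delE b (A : {set Z}) : z0 \notin A ->
    \bigcup_(z in A) del b z = \bigcup_(z in A) e z.
  move=> z0A; apply: eq_bigr => z zA; rewrite /del; case: eqP => // zz0.
  by rewrite -zz0 zA in z0A.
have delE1 b (A : {set Z}) : z0 \in A -> \bigcup_(z in A) del b z =
    (e z0 :\ b) :|: \bigcup_(z in A :\ z0) e z.
  move=> z0A; rewrite (big_setD1 z0) //= {1}/del eqxx delE //.
  by rewrite !inE eqxx.
have IH b : b \in e z0 ->
    (forall A : {set Z}, #|A| <= #|\bigcup_(z in A) del b z|) ->
    exists2 h : Z -> B, injective h & forall z, h z \in e z.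
  move=> bz Hd; suff [h hinj hd] : exists2 h : Z -> B, injective h &
      forall z, h z \in del b z.
    exists h => // z; have := hd z; rewrite /del; case: eqP => [->|] //.
    by rewrite !inE => /andP[].
  apply: IHN Hd.
  apply: leq_trans (leN : _ <= N); rewrite (bigD1 z0) //= [X in _ <= X](bigD1 z0) //=.
  rewrite -addSn leq_add //; first by rewrite /del eqxx [X in _ <= X](cardsD1 b) bz.
  by apply: leq_sum => z /negPf zz0; rewrite /del zz0.
have bad b : ~~ [forall A : {set Z}, #|A| <= #|\bigcup_(z in A) del b z|] ->
    exists2 A : {set Z}, z0 \notin A &
      #|(e z0 :\ b) :|: \bigcup_(z in A) e z| <= #|A|.
  case/forallPn=> A; rewrite -ltnNge => ltA.
  have z0A : z0 \in A.
    apply/negPn/negP => z0A; move: ltA; rewrite delE // ltnNge.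
    by rewrite Hall.
  exists (A :\ z0); first by rewrite !inE eqxx.
  by move: ltA; rewrite delE1 // (cardsD1 z0 A) z0A.
have [/forallP/(IH x xz)//|/bad[A1 z1 le1]] :=
  boolP [forall A : {set Z}, #|A| <= #|\bigcup_(z in A) del x z|].
have [/forallP/(IH y yz)//|/bad[A2 z2 le2]] :=
  boolP [forall A : {set Z}, #|A| <= #|\bigcup_(z in A) del y z|].
(* Submodularity: the two violating unions together cover the neighbourhood of [z0 |: (A1 :|: A2)],
   as [x != y], and both contain that of [A1 :&: A2]; Hall's condition for these two sets then
   exceeds [#|A1| + #|A2|]. *)
have := leq_add le1 le2; rewrite leqNgt => /negP[].
rewrite -cardsUI -[X in _ < X]cardsUI.
have leU := Hall (z0 |: (A1 :|: A2)).
have leI := Hall (A1 :&: A2).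
move: leU; rewrite cardsU1 !inE (negPf z1) (negPf z2) /= add1n => leU.
apply: leq_trans (leq_add leU leI) _; rewrite leq_add //; apply: subset_leq_card.
  rewrite bigcup_setU big_set1 bigcup_setU; apply/subsetP=> w; rewrite !inE.
  case/orP=> [wz|/orP[]->]; rewrite ?orbT //.
  by rewrite wz !andbT; case: (eqVneq w x) => [->|] //=; rewrite xy ?orbT.
apply/subsetP=> w /bigcupP[z]; rewrite !inE => /andP[zA1 zA2] wz.
by apply/andP; split; apply/orP; right; apply/bigcupP; exists z.
Qed.

(** Multiplying a^a by a! gives at most (2a)! = C(2a, a) (a!)^2, and the central binomial is at most
    4^a. *)
Lemma expn_self_leq a : a ^ a <= 4 ^ a * a`!.
Proof.
have le1 m : a ^ m * a`! <= (a + m)`!.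
  elim: m => [|m IHm]; first by rewrite addn0 mul1n.
  rewrite addnS factS expnS -mulnA leq_mul //; lia.
have bin4 : 'C(a + a, a) <= 4 ^ a.
  rewrite (_ : 4 ^ a = \sum_(i < (a + a).+1) 'C(a + a, i)); last first.
    rewrite -[4]/(2 * 2) expnMn -expnD -[2]/(1 + 1) expnDn.
    apply: eq_bigr => i _; by rewrite !exp1n !muln1.
  have Ha : a < (a + a).+1 by rewrite ltnS leq_addr.
  by rewrite (bigD1 (Ordinal Ha)) //= leq_addr.
have := le1 a; rewrite -(bin_fact (leq_addr a a)) addnK mulnA.
by rewrite leq_pmul2r ?fact_gt0 // => /leq_trans->//; rewrite leq_mul2r bin4 orbT.
Qed.

(** A division-free form of C(n, a) <= (4n / a)^a: the falling factorial is at most n^a, and a^a <=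
    4^a a!. *)
Lemma bin_expn_leq n a : 'C(n, a) * a ^ a <= (4 * n) ^ a.
Proof.
apply: leq_trans (leq_mul (leqnn _) (expn_self_leq a)) _.
rewrite mulnCA bin_ffact expnMn leq_mul2l orbC.
apply/orP; left; elim: a => // a IHa.
by rewrite ffactnSr expnSr leq_mul // leq_subr.
Qed.

Lemma card_ffun_into (P Q : finType) (A : {set P}) (B : {set Q}) :
  #|[set f : {ffun P -> Q} | [forall x in A, f x \in B]]| =
  #|B| ^ #|A| * #|Q| ^ #|~: A|.
Proof.
pose F x : pred Q := [pred y | (x \in A) ==> (y \in B)].
rewrite (_ : #|_| = #|family F|).
  rewrite card_family foldrE big_map enumT /= (bigID (mem A)) /=; congr (_ * _).
    rewrite -prod_nat_const; apply: eq_bigr => x xA.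
    by apply: eq_card => y; rewrite !inE xA.
  rewrite (eq_bigl (fun x => x \in ~: A)) => [|x]; last by rewrite inE.
  rewrite -prod_nat_const; apply: eq_bigr => x; rewrite inE => /negPf xA.
  by apply: eq_card => y; rewrite !inE xA.
apply: eq_card => f; rewrite inE; apply/forallP/familyP => /= fP x.
  by have := fP x.
by have := fP x.
Qed.

(* Union bound: a set [A] of [a] indices with fewer than [a] images is mapped
   into some set [B] of size [a], which a uniformly random map does with
   probability [(a / #|Q|) ^ (23 * a)]. *)
Lemma expander (P Q : finType) : #|P| <= 2 * #|Q| ->
  exists f : P -> 'I_23 -> Q, forall A : {set P}, 4 * #|A| <= 3 * #|Q| ->
    #|A| <= #|\bigcup_(z in A) [set f z i | i : 'I_23]|.
Proof.
move=> PQ; set p := #|P|; set q := #|Q|.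
pose D := 23; pose PD : finType := (P * 'I_D)%type.
pose Sa a := [set AB : {set P} * {set Q} | (#|AB.1| == a) && (#|AB.2| == a)].
pose into (AB : {set P} * {set Q}) : {set {ffun PD -> Q}} :=
  [set f : {ffun PD -> Q} | [forall x in setX AB.1 setT, f x \in AB.2]].
pose bad a := \bigcup_(AB in Sa a) into AB.
have leSa a : 4 * a <= 3 * q -> 4 ^ a * #|bad a| <= q ^ (p * D).
  move=> aq; case: (leqP a p) => ap; last first.
    rewrite (_ : bad a = set0) ?cards0 ?muln0 //.
    apply: big1 => -[A B]; rewrite inE => /andP[/eqP Aa _].
    by have := max_card (mem A); rewrite /= Aa leqNgt ap.
  have cSa : #|Sa a| = 'C(p, a) * 'C(q, a).
    rewrite -!card_draws -cardsX; apply: eq_card => -[A B].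
    by rewrite !inE.
  have leb : #|bad a| <= #|Sa a| * (a ^ (a * D) * q ^ ((p - a) * D)).
    apply: leq_card_bigcup => -[A B]; rewrite inE /= => /andP[/eqP Aa /eqP Ba].
    rewrite card_ffun_into Ba cardsX Aa cardsT card_ord cardsCs setCK.
    by rewrite cardsX Aa cardsT card_prod card_ord -mulnBl.
  rewrite (leq_trans (leq_mul (leqnn _) leb)) // cSa.
  rewrite (_ : p * D = a * D + (p - a) * D); last by rewrite -mulnDl subnKC.
  rewrite expnD !mulnA leq_mul // mulnC.
  (* Of the [23 * a] factors [a / q], [2 * a] cancel the denominators of the binomials. The others
     supply [128 ^ a]: [4 * a <= 3 * q] gives [2 * a ^ 3 <= q ^ 3], to be raised to the power
     [7 * a]. Here 128 = 4 * 2 * 4 * 4 is the cost of both binomials, of [p <= 2 * q] and of the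
     target [4 ^ a]. *)
  rewrite (_ : a * D = a + a + 21 * a); last by rewrite /D; lia.
  have le1 : 128 ^ a * (a ^ (21 * a)) <= q ^ (21 * a).
    rewrite (_ : 128 ^ a = 2 ^ (7 * a)); last by rewrite expnM.
    rewrite (_ : 21 * a = 3 * (7 * a)); last by rewrite mulnA.
    rewrite !expnM -!expnMn; have [->//|a0] := posnP a.
    rewrite leq_exp2r // leq_exp2r //.
    have: (4 * a) ^ 3 <= (3 * q) ^ 3 by rewrite leq_exp2r.
    rewrite !expnMn; lia.
  have le2 := bin_expn_leq p a; have le3 := bin_expn_leq q a.
  have le4 : (4 * p) ^ a * (4 * q) ^ a * 4 ^ a <= q ^ a * q ^ a * 128 ^ a.
    have [->//|a0] := posnP a.
    rewrite -!expnMn leq_exp2r //.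
    have : p * q <= 2 * q * q by rewrite leq_mul2r PQ orbT.
    lia.
  rewrite !(expnD _ _ (21 * a)) !(expnD _ a a).
  apply: leq_trans (_ : ((4 * p) ^ a * (4 * q) ^ a * 4 ^ a) * a ^ (21 * a) <= _).
    have := leq_mul (leq_mul le2 le3) (leqnn (4 ^ a * a ^ (21 * a))).
    move: ('C(p, a)) ('C(q, a)) (a ^ a) (4 ^ a) (a ^ (21 * a)) => x1 x2 x3 x4 x5.
    move: ((4 * p) ^ a) ((4 * q) ^ a) => x6 x7.
    lia.
  apply: leq_trans (leq_mul le4 (leqnn _)) _.
  by rewrite -!mulnA !leq_mul.
have [f0|] := boolP [exists f : {ffun PD -> Q},
    f \notin \bigcup_(a < (3 * q %/ 4).+1 | 0 < a) bad a].
  case/existsP: f0 => f fbad; exists (fun z i => f (z, i)) => A Aq.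
  rewrite leqNgt; apply/negP => ltA.
  (* The fewer than [#|A|] images are padded to a set of size exactly [#|A|], which puts [f] in
     [bad #|A|]. *)
  have [B sB Ba] : exists2 B : {set Q},
      \bigcup_(z in A) [set f (z, i) | i : 'I_23] \subset B & #|B| = #|A|.
    set U := \bigcup_(z in A) _ in ltA *.
    have [|B' sB' B'a] := @subset_of_card _ (~: U) (#|A| - #|U|).
      by have := cardsC U; rewrite -/q => Uq; lia.
    exists (U :|: B'); first exact: subsetUl.
    have -> : #|U :|: B'| = #|U| + #|B'|.
      by apply/eqP; rewrite (leq_card_setU U B') disjoints_subset -setCS setCK.
    by rewrite B'a subnKC // ltnW.
  case/negP: fbad; have Ha : #|A| < (3 * q %/ 4).+1 by lia.
  apply/bigcupP; exists (Ordinal Ha) => /=; first by case: #|A| ltA.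
  apply/bigcupP; exists (A, B); first by rewrite inE /= Ba !eqxx.
  rewrite inE; apply/forall_inP => -[z i]; rewrite !inE /= andbT => zA.
  apply: (subsetP sB); apply/bigcupP; exists z => //.
  by apply/imsetP; exists i.
move=> noex; pose S n := \bigcup_(a < n.+1 | 0 < a) bad a.
(* Geometric sum: sizes 1 to [n] account for at most a fraction (1 - 4^-n) / 3 of all maps, so not
   every map is bad. *)
have leS n : 4 * n <= 3 * q ->
    3 * 4 ^ n * #|S n| + q ^ (p * D) <= 4 ^ n * q ^ (p * D).
  elim: n => [|n IHn] nq.
    by rewrite /S big_mkcond big_ord1 cards0 muln0 mul1n.
  have {}IHn := IHn (leq_trans (leq_mul (leqnn 4) (leqnSn n)) nq).
  have : #|S n.+1| <= #|S n| + #|bad n.+1|.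
    by rewrite /S big_mkcond big_ord_recr -big_mkcond leq_card_setU.
  have := leSa n.+1 nq; rewrite !(expnS 4 n).
  move: IHn; move: (4 ^ n) (q ^ _) #|S n| #|bad _| #|S _|; nia.
have Sfull : #|S (3 * q %/ 4)| = q ^ (p * D).
  rewrite (_ : S _ = setT).
    by rewrite cardsT card_ffun card_prod card_ord.
  apply/setP=> f; rewrite [RHS]inE; apply/negPn/negP => fb.
  by case/negP: noex; apply/existsP; exists f.
have qp : 0 < q ^ (p * D).
  rewrite expn_gt0; have [q0|//] := posnP q.
  by have := PQ; rewrite -/p -/q q0 muln0 leqn0 => /eqP->.
have ep : 0 < 4 ^ (3 * q %/ 4) by rewrite expn_gt0.
have : 4 * (3 * q %/ 4) <= 3 * q by rewrite mulnC leq_trunc_div.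
by move/leS; rewrite Sfull; move: (q ^ _) (4 ^ _) qp ep; nia.
Qed.

(* Montgomery's robustly matchable bipartite graph; its edges are indexed by
   [T], and [zof] and [bof] are the endpoint maps. *)
Lemma robustly_matchable (X Y Z : finType) m :
  #|X| <= 4 * m -> #|Y| = 2 * m -> #|Z| = 3 * m ->
  exists (T : finType) (zof : T -> Z) (bof : T -> X + Y),
    #|T| <= 207 * m /\
    forall X' : {set X}, #|X'| = m ->
      exists2 tau : Z -> T, cancel tau zof &
        injective (bof \o tau) /\
        forall b, (b \in codom (bof \o tau)) =
                  (if b is inl x then x \in X' else true).
Proof.
move=> Xm Ym Zm.
have [|f1 exp1] := @expander Z Y; first by rewrite Zm Ym; lia.
have [|f2 exp2] := @expander (X + Y)%type Z; first by rewrite card_sum Zm Ym; lia.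
(* 23 edges go from each vertex of [Z] to [Y], and 23 from each vertex of [X + Y] to [Z]: at most 23
   * (3 + 6) * m = 207 * m in all. *)
pose T : finType := (Z * 'I_23 + (X + Y) * 'I_23)%type.
pose zof (t : T) : Z :=
  match t with inl zi => zi.1 | inr bi => f2 bi.1 bi.2 end.
pose bof (t : T) : X + Y :=
  match t with inl zi => inr (f1 zi.1 zi.2) | inr bi => bi.1 end.
exists T, zof, bof; split=> [|X' X'm].
  by rewrite card_sum !card_prod card_sum card_ord Zm Ym; lia.
pose B : {set X + Y} := [set b | if b is inl x then x \in X' else true].
have Bm : #|B| = 3 * m.
  rewrite (_ : B = inl @: X' :|: inr @: setT); last first.
    apply/setP=> -[x|y]; rewrite !inE /=.
      rewrite (mem_imset _ _ inl_inj) orbC; case: imsetP => // -[? _ //].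
    by rewrite orbC imset_f.
  rewrite cardsU (_ : _ :&: _ = set0) ?cards0.
    rewrite !card_imset ?cardsT ?X'm ?Ym ?subn0; first by lia.
      exact: inr_inj.
    exact: inl_inj.
  by apply/setP=> b; rewrite !inE; apply/andP => -[/imsetP[x _ ->] /imsetP[]].
pose e z : {set X + Y} := [set b in B | [exists t, (zof t == z) && (bof t == b)]].
have [A|h hinj he] := @hall _ _ e.
  have [Am|Am] := leqP (2 * #|A|) (3 * m).
    apply: leq_trans (exp1 A _) _; first by rewrite Ym; lia.
    rewrite -(card_imset _ (@inr_inj X Y)); apply: subset_leq_card.
    apply/subsetP=> _ /imsetP[y /bigcupP[z zA /imsetP[i _ ->]] ->].
    apply/bigcupP; exists z => //; rewrite !inE /=.
    by apply/existsP; exists (inl (z, i)); rewrite /= !eqxx.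
  (* For large [A], expansion is used from the other side: more than [3 * m - #|A|] vertices of [B]
     would miss [N], and their images under [f2] avoid [A] but are too many to fit outside it. *)
  rewrite leqNgt; apply/negP => ltA.
  have leA : #|A| <= 3 * m by rewrite -Zm max_card.
  set N := \bigcup_(z in A) e z in ltA.
  have [|C sC Cm] := @subset_of_card _ (B :\: N) (3 * m - #|A|).+1.
    by have := cardsID N B; have := subset_leq_card (subsetIr B N); lia.
  have := exp2 C; rewrite Cm Zm => /(_ _)H.
  have {H} : (3 * m - #|A|).+1 <= #|~: A|.
    apply: leq_trans (H _) _; first by lia.
    apply: subset_leq_card; apply/subsetP=> _ /bigcupP[b bC /imsetP[i _ ->]].
    rewrite inE; apply/negP => fA.
    have := subsetP sC b bC; rewrite inE => /andP[/negP bN bB].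
    apply: bN; apply/bigcupP; exists (f2 b i) => //; rewrite inE bB.
    by apply/existsP; exists (inr (b, i)); rewrite /= !eqxx.
  by have := cardsC A; rewrite Zm; lia.
have /fin_all_exists[tau tauP] z : exists t, zof t = z /\ bof t = h z.
  by have := he z; rewrite inE => /andP[_ /existsP[t /andP[/eqP ? /eqP ?]]]; exists t.
have bt : bof \o tau =1 h by move=> z; case: (tauP z).
exists tau => [z|]; first by case: (tauP z).
split=> [z z'|b]; first by rewrite !bt; apply: hinj.
rewrite (eq_codom bt) (_ : (if b is inl x then _ else _) = (b \in B)); last first.
  by rewrite inE.
have <- : h @: setT = B.
  apply/eqP; rewrite eqEcard card_imset // cardsT Bm Zm leqnn andbT.
  by apply/subsetP=> _ /imsetP[z _ ->]; have := he z; rewrite inE => /andP[].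
apply/codomP/imsetP => [[z ->]|[z _ ->]]; first by exists z.
by exists z.
Qed.

(** * Sets meeting many large sets *)

(* Greedy choice driven by the potential [\sum_i 2 ^- #|F i :&: X|]. *)
Lemma uniform_hitting (I V : finType) (F : I -> {set V}) (p m : nat) :
  0 < p -> (forall i, #|V| <= p * #|F i|) -> 24 * p ^ 2 * m <= #|V| ->
  #|I| < 2 ^ m ->
  exists2 X : {set V}, #|X| <= 12 * p * m & forall i, m <= #|F i :&: X|.
Proof.
move=> p_gt0 Fp mV Im.
pose w (X : {set V}) i : rat := (2^-1 ^+ #|F i :&: X|)%R.
pose Phi X : rat := (\sum_i w X i)%R.
have w_ge0 X i : (0 <= w X i)%R by rewrite exprn_ge0 // invr_ge0.
have Phi0 X : (0 <= Phi X)%R by apply: sumr_ge0.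
have bernoulli (x : rat) n : (0 <= x <= 1 -> (1 - x) ^+ n * (1 + n%:R * x) <= 1)%R.
  case/andP=> x0 x1; elim: n => [|n IHn]; first by rewrite expr0 mul0r addr0 mulr1.
  apply: le_trans IHn; rewrite exprSr -mulrA ler_wpM2l ?exprn_ge0 ?subr_ge0 //.
  rewrite -natr1; have : (0 <= n%:R :> rat)%R by []; nra.
pose r : rat := (1 - (4 * p%:R)^-1)%R.
have p1 : (1 <= p%:R :> rat)%R by rewrite ler1n.
have x01 : (0 <= (4 * p%:R : rat)^-1 <= 1)%R.
  rewrite invr_ge0 mulr_ge0 //= invf_le1 ?mulr_gt0 ?ltr0n //; lra.
have r_ge0 : (0 <= r)%R by rewrite subr_ge0; case/andP: x01.
(* On average over the vertices outside [X], the sets through a vertex carry at least 1 / (2p) of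
   the potential, and adding the vertex halves their weights; so some choice shrinks [Phi] by the
   factor [r]. *)
have step (X : {set V}) : 2 * p * #|X| < #|V| ->
    exists2 x, x \notin X & (Phi (x |: X) <= r * Phi X)%R.
  move=> XV.
  have gain (x : V) : x \notin X ->
      (Phi (x |: X) = Phi X - 2^-1 * \sum_(i | x \in F i) w X i)%R.
    move=> xX; rewrite /Phi [in RHS](bigID (fun i => x \in F i)) /=.
    rewrite (bigID (fun i => x \in F i)) /=.
    rewrite (eq_bigr (fun i => 2^-1 * w X i)%R); last first.
      move=> i xi; rewrite /w -exprS; congr (_ ^+ _)%R.
      rewrite setIUr (_ : F i :&: [set x] = [set x]); last first.
        by apply/setIidPr; rewrite sub1set.
      by rewrite cardsU1 inE (negPf xX) andbF.
    rewrite -mulr_sumr [X in (_ + X)%R](eq_bigr (w X)); last first.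
      move=> i xi; congr (_ ^+ _)%R; congr #|pred_of_set _|.
      by apply/setP=> y; rewrite !inE; case: eqP => // ->; rewrite (negPf xi).
    by field.
  pose S x := (\sum_(i | x \in F i) w X i)%R.
  have [/exists_inP[x xX Sx]|] :=
    boolP [exists x in ~: X, (Phi X <= 2 * p%:R * S x)%R].
    rewrite inE in xX; exists x => //; rewrite gain // -/(S x) /r.
    rewrite mulrBl mul1r lerD2l lerN2 ler_pdivrMl ?mulr_gt0 ?ltr0n //.
    by rewrite (le_trans Sx) // le_eqVlt; apply/orP; left; apply/eqP; field.
  rewrite negb_exists_in => /forall_inP Slt.
  have SE : (\sum_(x in ~: X) S x = \sum_i #|F i :\: X|%:R * w X i)%R.
    rewrite /S (exchange_big_dep xpredT) //=; apply: eq_bigr => i _.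
    rewrite sumr_const -[LHS]mulr_natl; congr (_%:R * _)%R; apply: eq_card => x.
    by rewrite unfold_in !inE.
  have lo : ((#|V| - p * #|X|)%:R * Phi X <= p%:R * \sum_(x in ~: X) S x)%R.
    rewrite SE /Phi !mulr_sumr; apply: ler_sum => i _.
    rewrite mulrA ler_wpM2r // -natrM ler_nat.
    have := Fp i; have := cardsID X (F i).
    by have := subset_leq_card (subsetIr (F i) X); nia.
  have hi : (2 * p%:R * \sum_(x in ~: X) S x <= #|~: X|%:R * Phi X)%R.
    rewrite mulr_sumr [leRHS]mulr_natl -sumr_const; apply: ler_sum => x.
    by move/Slt; rewrite -ltNge => /ltW.
  have [x xX] : exists x, x \in ~: X.
    by apply/card_gt0P; have := cardsC X; nia.
  have Phi_gt0 : (0 < Phi X)%R.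
    have S0 : (0 <= S x)%R by apply: sumr_ge0.
    have := Slt x xX; rewrite -ltNge; apply: le_lt_trans.
    by rewrite !mulr_ge0.
  have : (2 * (#|V| - p * #|X|) <= #|~: X|).
    rewrite -(ler_nat rat) -(ler_pM2r Phi_gt0); apply: le_trans hi.
    by rewrite natrM -!mulrA ler_wpM2l.
  by have := cardsC X; nia.
have [X Xm PhiX] : exists2 X : {set V}, #|X| <= 12 * p * m &
    (Phi X <= r ^+ (12 * p * m) * #|I|%:R)%R.
  have : 12 * p * m <= 12 * p * m by [].
  elim: {1 3 4}(12 * p * m) => [|j IHj] jm.
    exists set0; rewrite ?cards0 // mul1r /Phi (eq_bigr (fun=> 1%R)).
      by rewrite sumr_const.
    by move=> i _; rewrite /w setI0 cards0.
  have [X Xj PX] := IHj (ltnW jm).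
  (* [24 * p ^ 2 * m <= #|V|] keeps [2 * p * #|X|] below [#|V|] during all [12 * p * m] rounds. *)
  have [|x xX Px] := step X; first by nia.
  exists (x |: X); first by rewrite cardsU1 xX.
  rewrite (le_trans Px) // exprS -mulrA ler_wpM2l //.
exists X => // i; rewrite leqNgt; apply/negP => ltm.
(* Every 12p rounds divide the potential by at least 1 + 12p / (4p) = 4. After [m] such blocks it is
   below 4^-m 2^m = 2^-m, whereas a set met fewer than [m] times alone weighs at least 2^-m. *)
have r4 : (r ^+ (12 * p) <= 4^-1)%R.
  have := bernoulli _ (12 * p) x01; rewrite -/r natrM.
  rewrite (_ : 1 + _ = 4)%R => [r4|]; last by field; lra.
  by rewrite -[leRHS]mul1r ler_pdivlMr.
have : (w X i <= Phi X)%R by rewrite /Phi (bigD1 i) //= lerDl sumr_ge0.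
move/le_trans/(_ PhiX); rewrite exprM => lew.
have r4m : (r ^+ (12 * p) ^+ m <= 4^-1 ^+ m)%R.
  by apply: lerXn2r; rewrite ?nnegrE ?invr_ge0 ?exprn_ge0 ?r_ge0.
have Im' : (#|I|%:R < 2%:R ^+ m :> rat)%R by rewrite -natrX ltr_nat.
have : (2^-1 ^+ m <= w X i)%R.
  by apply: ler_wiXn2l; rewrite ?invr_ge0 ?invf_le1 // ltnW.
move/le_trans/(_ lew)/le_trans/(_ (ler_wpM2r (ler0n _ _) r4m)).
rewrite leNgt => /negP[]; apply: lt_le_trans (_ : 4^-1 ^+ m * 2 ^+ m <= _)%R.
  by rewrite ltr_pM2l ?exprn_gt0 ?invr_gt0.
by rewrite -exprMn (_ : 4^-1 * 2 = 2^-1)%R //; apply/eqP.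
Qed.

(** * Clique tilings and exchanges *)

Definition nbhd (G : sgraph) (v : G) : {set G} := [set w | adj v w].

Definition kclique (G : sgraph) (k : nat) (K : {set G}) : bool :=
  (#|K| == k) && [forall x in K, forall y in K, (x != y) ==> adj x y].

(** Keeps only the vertex set of a tiling by [k]-cliques, which is all that exchange and absorption
    refer to. *)
Inductive tileable (G : sgraph) (k : nat) : {set G} -> Prop :=
| tileable0 : tileable k set0
| tileable_add (K A : {set G}) : kclique k K -> [disjoint K & A] ->
    tileable k A -> tileable k (K :|: A).

(** The form in which the bound on [alpha_ k G] enters the construction. *)
Definition clique_rich (G : sgraph) (k a : nat) : Prop :=
  forall U : {set G}, a < #|U| -> exists2 K : {set G}, K \subset U & kclique k K.

Lemma kcliqueP (G : sgraph) k (K : {set G}) :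
  reflect (#|K| = k /\ {in K &, forall x y, x != y -> adj x y}) (kclique k K).
Proof.
apply: (iffP andP) => [[/eqP Kk /forall_inP adjK]|[Kk adjK]]; split=> //.
- by move=> x y /adjK/forall_inP/[apply]/implyP.
- exact/eqP.
- by apply/forall_inP => x xK; apply/forall_inP => y yK; apply/implyP/adjK.
Qed.

Arguments kcliqueP {G k K}.

Lemma tileable_clique (G : sgraph) k (K : {set G}) : kclique k K -> tileable k K.
Proof.
move=> cK; rewrite -[K]setU0; apply: tileable_add (tileable0 _ _) => //.
by rewrite -setI_eq0 setI0.
Qed.

Lemma tileableU (G : sgraph) k (A B : {set G}) :
  [disjoint A & B] -> tileable k A -> tileable k B -> tileable k (A :|: B).
Proof.
move=> + tA tB; elim: tA => [|K A' cK dKA' _ IH dAB]; first by rewrite set0U.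
move: dAB; rewrite disjoint_sym disjointsUr => /andP[dBK dBA'].
rewrite -setUA; apply: tileable_add => //; last by apply: IH; rewrite disjoint_sym.
by rewrite disjointsUr dKA' disjoint_sym.
Qed.

Lemma tileable_bigcup (G : sgraph) k (I : finType) (F : I -> {set G}) :
  (forall i, tileable k (F i)) ->
  (forall i j, i != j -> [disjoint F i & F j]) ->
  tileable k (\bigcup_i F i).
Proof.
move=> tF dF; have := enum_uniq I; rewrite -big_enum /=.
elim: (enum I) => [|i s IH]; first by rewrite big_nil; constructor.
rewrite big_cons => /andP[si us]; apply: tileableU (IH us) => //.
rewrite big_tnth; apply: disjoint_bigcupr => j _; apply: dF.
by apply: contraNneq si => ->; rewrite mem_tnth.
Qed.

Lemma tile_greedy (G : sgraph) k a (U : {set G}) : 0 < k -> clique_rich G k a ->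
  exists A : {set G}, [/\ A \subset U, tileable k A & #|U :\: A| <= a].
Proof.
move=> k_gt0 rich; have [N] := ubnP #|U|; elim: N U => // N IHN U UN.
have [Ua|aU] := leqP #|U| a.
  by exists set0; rewrite sub0set setD0; split=> //; constructor.
have [K sKU cK] := rich U aU; have [Kk _] := kcliqueP cK.
have [|A [sA tA UA]] := IHN (U :\: K).
  by rewrite cardsDS // Kk; have := subset_leq_card sKU; lia.
move: sA; rewrite subsetD => /andP[sAU dAK].
exists (K :|: A); split; first by rewrite subUset sKU.
  by apply: tileable_add => //; rewrite disjoint_sym.
by rewrite -setDDl.
Qed.

(** * Exchanging two vertices, and the resulting classes *)

(** Once [S] is set aside, either of [u] and [v] can be covered together with it, leaving the other
    free. *)
Definition exchanger (G : sgraph) k (u v : G) (S : {set G}) : Prop :=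
  [/\ u \notin S, v \notin S, tileable k (u |: S) & tileable k (v |: S)].

(* [linked e th t u v] : [u] and [v] can be exchanged through a chain of
   direct exchanges, each intermediate vertex being one of at least [th]. *)
Fixpoint linked (G : sgraph) (e th t : nat) (u v : G) : bool :=
  if t is t'.+1 then
    linked e th t' u v ||
    (th <= #|[set z | linked e th t' u z && linked e th t' z v]|)
  else e <= #|nbhd u :&: nbhd v|.

Lemma linked_sym (G : sgraph) e th t : symmetric (@linked G e th t).
Proof.
elim: t => [|t IHt] u v /=; first by rewrite setIC.
rewrite (IHt u v); congr (_ || (_ <= #|pred_of_set _|)).
by apply/setP=> z; rewrite !inE andbC (IHt v z) (IHt z u).
Qed.

Lemma linked_mono (G : sgraph) e th t t' (u v : G) :
  t <= t' -> linked e th t u v -> linked e th t' u v.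
Proof.
move=> /subnKC <-; elim: (t' - t) => [|j IHj] H; first by rewrite addn0.
by rewrite addnS /= IHj.
Qed.

Lemma cliqueD1_nbhd (G : sgraph) k (K : {set G}) (x u : G) :
  kclique k K -> x \in K -> K \subset nbhd u ->
  u \notin K :\ x /\ kclique k (u |: K :\ x).
Proof.
case/kcliqueP=> Kk adjK xK Ku.
have uK : u \notin K.
  by apply/negP => /(subsetP Ku); rewrite inE adj_irr.
have uKx : u \notin K :\ x by rewrite inE negb_and uK orbT.
split=> //; apply/kcliqueP; split.
  by rewrite cardsU1 uKx -Kk (cardsD1 x K) xK.
move=> y z; rewrite !inE.
case/orP=> [/eqP->|/andP[_ yK]]; case/orP=> [/eqP->|/andP[_ zK]].
- by rewrite eqxx.
- by move=> _; have := subsetP Ku z zK; rewrite inE.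
- by move=> _; have := subsetP Ku y yK; rewrite inE adj_sym.
- exact: adjK.
Qed.

(** Level 0 uses a [k]-clique of the common neighbourhood less one vertex. Above, an intermediate
    [z] outside [W], with disjoint [S1] for [u, z] and [S2] for [z, v], gives [z |: (S1 :|: S2)]:
    either [u] joins [S1] and [z] joins [S2], or [z] joins [S1] and [v] joins [S2]. The strict size
    bound leaves room for [z]. *)
Lemma linked_exchanger (G : sgraph) k a e th t (u v : G) (W : {set G}) :
  0 < k -> clique_rich G k a -> linked e th t u v ->
  #|W| + a + 4 * (k * 2 ^ t) <= e -> #|W| + 4 * (k * 2 ^ t) <= th ->
  exists S : {set G}, [/\ [disjoint S & W], #|S| < k * 2 ^ t
                        & exchanger k u v S].
Proof.
move=> k_gt0 rich; elim: t u v W => [|t IHt] u v W /=.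
  move=> euv We Wth.
  have [|K sK cK] := rich ((nbhd u :&: nbhd v) :\: W).
    have := cardsID W (nbhd u :&: nbhd v).
    by have := subset_leq_card (subsetIr (nbhd u :&: nbhd v) W); nia.
  have [Kk _] := kcliqueP cK.
  have [x xK] : exists x, x \in K by apply/card_gt0P; rewrite Kk.
  move: sK; rewrite subsetD subsetI => /andP[/andP[Ku Kv] dKW].
  have [uS cu] := cliqueD1_nbhd cK xK Ku; have [vS cv] := cliqueD1_nbhd cK xK Kv.
  exists (K :\ x); split.
  - exact: disjointWl (subD1set _ _) dKW.
  - by rewrite muln1 -Kk (cardsD1 x K) xK.
  - by split=> //; apply: tileable_clique.
rewrite expnS (mulnCA k 2).
have k2 : 0 < k * 2 ^ t by rewrite muln_gt0 k_gt0 expn_gt0.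
set b := k * 2 ^ t in IHt k2 * => /orP[luv|lz] We Wth.
  by have [||S [dS sS eS]] := IHt u v W luv; [lia..|exists S; split=> //; lia].
have [z] : exists z, z \in [set z | linked e th t u z && linked e th t z v] :\:
    (W :|: [set u; v]).
  apply/card_gt0P; rewrite cardsD subn_gt0; apply: leq_trans lz.
  apply: leq_ltn_trans (subset_leq_card (subsetIr _ _)) _.
  apply: leq_ltn_trans (leq_cardsU _ _) _.
  by have := cards2_leq u v; lia.
rewrite !inE !negb_or => /andP[/and3P[zW zu zv] /andP[luz lzv]].
have [||S1 [dS1 sS1 [uS1 zS1 tu1 tz1]]] := IHt u z (W :|: [set u; v]) luz.
- by have := leq_cardsU W [set u; v]; have := cards2_leq u v; lia.
- by have := leq_cardsU W [set u; v]; have := cards2_leq u v; lia.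
have W2 : #|W :|: [set u; v] :|: (z |: S1)| <= #|W| + 2 + b + 1.
  have := leq_cardsU (W :|: [set u; v]) (z |: S1).
  have := leq_cardsU W [set u; v]; have := cards2_leq u v.
  by have := cardsU1 z S1; rewrite zS1; lia.
have [||S2 [dS2 sS2 [zS2 vS2 tz2 tv2]]] :=
  IHt z v (W :|: [set u; v] :|: (z |: S1)) lzv; [lia..|].
have [dS1W dS1uv] : [disjoint S1 & W] /\ [disjoint S1 & [set u; v]].
  by apply/andP; rewrite -disjointsUr.
move: dS2; rewrite !disjointsUr => /andP[/andP[dS2W /andP[dS2u _]] /andP[_ dS21]].
have vS1 : v \notin S1 by rewrite (disjointFl dS1uv) // !inE eqxx orbT.
have uS2 : u \notin S2 by rewrite (disjointFl dS2u) // inE.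
have d1 x : x \notin S2 -> x != z -> [disjoint x |: S1 & z |: S2].
  move=> xS2 xz; apply/disjointsP=> y /setU1P[->|yS1]; rewrite !inE.
    by rewrite (negPf xz) (negPf xS2).
  case/orP=> [/eqP yz|yS2]; first by rewrite yz (negPf zS1) in yS1.
  by rewrite (disjointFr dS21 yS2) in yS1.
have d2 x : x \notin S1 -> x != z -> [disjoint z |: S1 & x |: S2].
  move=> xS1 xz; apply/disjointsP=> y /setU1P[->|yS1]; rewrite !inE.
    by rewrite eq_sym (negPf xz) (negPf zS2).
  case/orP=> [/eqP yx|yS2]; first by rewrite yx (negPf xS1) in yS1.
  by rewrite (disjointFr dS21 yS2) in yS1.
exists (z |: (S1 :|: S2)); split.
- apply/disjointsP=> y /setU1P[->|/setUP[yS|yS] yW]; first exact/negP.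
    by rewrite (disjointFr dS1W yS) in yW.
  by rewrite (disjointFr dS2W yS) in yW.
- rewrite cardsU1; apply: leq_ltn_trans (_ : 1 + (#|S1| + #|S2|) < _).
    by apply: leq_add; [case: (_ \notin _)|apply: leq_cardsU].
  by rewrite mul2n -addnn add1n -addSn -addnS leq_add // ltnW.
split; rewrite ?inE ?negb_or ?(eq_sym u z) ?(eq_sym v z) ?zu ?zv ?uS1 ?uS2 ?vS1 //.
- rewrite (_ : u |: _ = (u |: S1) :|: (z |: S2)).
    by apply: tileableU => //; apply: d1; rewrite // eq_sym.
  by rewrite [RHS]setUACA setUA.
- rewrite (_ : v |: _ = (z |: S1) :|: (v |: S2)).
    by apply: tileableU => //; apply: d2; rewrite // eq_sym.
  by rewrite [RHS]setUACA setUCA setUA.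
Qed.

(* At some level [t <= c] the independence number of [linked] is the same at
   levels [t] and [t.+1]. A maximum independent set [I] of level [t.+1] then
   dominates at level [t], the neighbourhoods at level [t] of its members
   barely overlap, and outside the overlap [B] each of them is a clique. *)
Lemma closed_classes (G : sgraph) e th c :
  (forall A : {set G},
     {in A &, forall u v, u != v -> ~~ linked e th 0 u v} -> #|A| <= c) ->
  (forall u : G, e <= #|nbhd u|) ->
  (forall u : G, (c * c + c) * th < #|[set w | linked e th 0 u w]|) ->
  exists (I : {set G}) (cl : G -> G),
    [/\ #|I| <= c, forall u, cl u \in I,
        forall u, th <= #|[set v | cl v == cl u]|
      & forall u v, cl u = cl v -> linked e th c.+2 u v].
Proof.
move=> indc nbe nb0; pose L := @linked G e th.
have Lrefl t u : L t u u by apply: (@linked_mono G e th 0) => //=; rewrite setIid.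
pose indep t (A : {set G}) :=
  [forall u in A, forall v in A, (u != v) ==> ~~ L t u v].
have indepP t (A : {set G}) :
    reflect {in A &, forall u v, u != v -> ~~ L t u v} (indep t A).
  apply: (iffP forall_inP) => [H u v uA vA|H u uA].
    by have /forall_inP/(_ v vA)/implyP := H u uA.
  by apply/forall_inP => v vA; apply/implyP/H.
have indep0 t : indep t set0 by apply/indepP => u v; rewrite inE.
pose Imax t := [arg max_(A > set0 | indep t A) #|A|].
have ImaxP t : indep t (Imax t) /\ forall A : {set G}, indep t A -> #|A| <= #|Imax t|.
  by rewrite /Imax; case: arg_maxnP.
(* The maximum is at most [c] at level 0, so it cannot drop strictly [c.+1] times. *)
have [t tc It] : exists2 t, t <= c & #|Imax t| <= #|Imax t.+1|.
  have [/existsP[t]|] := boolP [exists t : 'I_c.+1, #|Imax t| <= #|Imax t.+1|].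
    by exists t => //; rewrite -ltnS.
  rewrite negb_exists => /forallP no.
  have dec t : t <= c.+1 -> #|Imax t| + t <= c.
    elim: t => [|t IHt] tc.
      rewrite addn0; apply: indc; exact: (elimT (indepP 0 _) (ImaxP 0).1).
    by have := no (Ordinal tc); have := IHt (ltnW tc); rewrite -ltnNge /=; lia.
  by have := dec c.+1 (leqnn _); lia.
pose I := Imax t.+1; have [/indepP Iind _] := ImaxP t.+1.
have maxI (A : {set G}) : indep t A -> #|A| <= #|I|.
  by move/(ImaxP t).2 => /leq_trans; apply.
have Iindt : {in I &, forall u v, u != v -> ~~ L t u v}.
  move=> u v uI vI uv; apply: contra (Iind u v uI vI uv).
  exact: linked_mono.
have Ic : #|I| <= c.
  apply: indc => u v uI vI uv; apply: contra (Iind u v uI vI uv).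
  exact: linked_mono.
have dom u : exists2 v, v \in I & L t u v.
  have [uI|uI] := boolP (u \in I); first by exists u.
  have [/exists_inP[v vI uv]|] := boolP [exists v in I, L t u v].
    by exists v.
  rewrite negb_exists_in => /forall_inP no.
  suff /maxI : indep t (u |: I) by rewrite cardsU1 uI ltnn.
  apply/indepP => x y /setU1P[->|xI] /setU1P[->|yI] //; first by rewrite eqxx.
  - by move=> _; apply: no.
  - by move=> _; rewrite /L linked_sym; apply: no.
  - exact: Iindt.
pose B := [set w | [exists v in I, exists v' in I,
                      [&& v != v', L t w v & L t w v']]].
(* Distinct members of [I] are unlinked at level [t.+1], hence have fewer than [th] common
   neighbours at level [t]. *)
have Bsmall : #|B| <= c * c * th.
  apply: leq_trans (_ : #|setX I I| * th <= _); last first.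
    by rewrite cardsX leq_mul2r leq_mul ?orbT.
  pose F (p : G * G) := if p.1 == p.2 then set0 else
    [set z | linked e th t p.1 z && linked e th t z p.2].
  apply: leq_trans (leq_card_bigcup (P := fun p => p \in setX I I) (F := F) _).
    apply: subset_leq_card; apply/subsetP=> w; rewrite inE.
    case/exists_inP=> v vI /exists_inP[v' vI' /and3P[vv' wv wv']].
    apply/bigcupP; exists (v, v'); first by rewrite in_setX; apply/andP.
    by rewrite /F (negPf vv') inE linked_sym; apply/andP.
  case=> v v'; rewrite inE /= => /andP[vI vI']; rewrite /F /=.
  case: eqVneq => [_|vv']; first by rewrite cards0.
  have := Iind v v' vI vI' vv'; rewrite /L /= negb_or -ltnNge => /andP[_].
  exact: ltnW.
pose core v := [set w | L t w v] :\: B.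
have coreN v w v' : v \in I -> w \in core v -> v' \in I -> L t w v' -> v' = v.
  move=> vI; rewrite !inE => /andP[wB wv] vI' wv'; apply/eqP.
  apply: contraNT wB => vv'; apply/exists_inP; exists v' => //.
  by apply/exists_inP; exists v => //; rewrite vv' wv'.
(* No member of [I] other than [v] is linked to a vertex of its core; if [w] and [w'] were unlinked,
   replacing [v] by both would give a larger independent set at level [t]. *)
have coreL v w w' : v \in I -> w \in core v -> w' \in core v -> L t w w'.
  move=> vI wv wv'; have [->//|ww'] := eqVneq w w'.
  apply/negPn/negP => Lww'.
  have out x : x \in core v -> x \notin I :\ v.
    move=> xv; rewrite !inE; apply/negP => /andP[xv' xI].
    by case/eqP: xv'; apply: coreN xv xI _.
  have no x y : x \in core v -> y \in I :\ v -> ~~ L t x y.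
    move=> xv; rewrite !inE => /andP[yv yI].
    by apply: contra yv => /(coreN _ _ _ vI xv yI)->.
  suff /maxI : indep t (w |: (w' |: (I :\ v))).
    rewrite !cardsU1 in_setU1 negb_or ww' !out //=.
    by rewrite (cardsD1 v I) vI ltnn.
  have Lw'w : ~~ L t w' w by rewrite /L linked_sym.
  have no' x y : x \in I :\ v -> y \in core v -> ~~ L t x y.
    by move=> xI yv; rewrite /L linked_sym; apply: no.
  apply/indepP => x y; rewrite 2!in_setU1 => /or3P[/eqP->|/eqP->|xI];
    rewrite 2!in_setU1 => /or3P[/eqP->|/eqP->|yI]; rewrite ?eqxx //;
    try by move=> _; auto.
  by apply: Iindt; [move: xI|move: yI]; rewrite in_setD1 => /andP[].
(* Of the more than [(c * c + c) * th] neighbours of [u], at most [c * c * th] lie in [B]; the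
   others spread over at most [c] cores. *)
have deg u : exists2 v, v \in I & th <= #|[set w in core v | L t u w]|.
  apply/exists_inP; rewrite -[X in is_true X]negbK negb_exists_in.
  apply/negP => /forall_inP no.
  have := nb0 u; rewrite ltnNge => /negP[]; rewrite mulnDl.
  pose F v := [set w in core v | L t u w].
  apply: leq_trans (_ : #|B :|: \bigcup_(v in I) F v| <= _).
    apply: subset_leq_card; apply/subsetP=> w; rewrite inE => uw.
    rewrite inE; case: (boolP (w \in B)) => //= wB.
    have [v vI wv] := dom w; apply/bigcupP; exists v => //.
    rewrite in_set in_setD wB inE wv.
    exact: linked_mono (leq0n t) uw.
  apply: leq_trans (leq_cardsU _ _) _; apply: leq_add => //.
  apply: leq_trans (leq_card_bigcup (b := th) _) _; last by rewrite leq_mul2r Ic orbT.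
  by move=> v vI; rewrite ltnW // ltnNge no.
pose good u v := (v \in I) && (th <= #|[set w in core v | L t u w]|).
(* Sending all of a large core to its own centre makes every class contain such a core, which bounds
   its size from below. *)
have [cl clP clE] : exists2 cl : G -> G, forall u, good u (cl u) &
    forall u v, v \in I -> u \in core v -> th <= #|core v| -> cl u = v.
  suff /fin_all_exists[cl clP] u : exists v, good u v /\
      forall v', v' \in I -> u \in core v' -> th <= #|core v'| -> v = v'.
    by exists cl => [u|u]; case: (clP u).
  have [/exists_inP[v vI /andP[uv thv]]|] :=
    boolP [exists v in I, (u \in core v) && (th <= #|core v|)].
    exists v; split=> [|v' v'I uv' _].
      apply/andP; split=> //; apply: leq_trans thv _; apply: subset_leq_card.
      by apply/subsetP=> w wv; rewrite inE wv /=; apply: coreL wv.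
    by apply: coreN uv' vI _ => //; move: uv; rewrite !inE => /andP[].
  rewrite negb_exists_in => /forall_inP no; have [v vI thv] := deg u.
  exists v; split; first exact/andP.
  by move=> v' v'I uv' thv'; have := no v' v'I; rewrite uv' thv'.
exists I, cl; split=> // [u|u|u u' uu'].
- by case/andP: (clP u).
- case/andP: (clP u) => uI le1; apply: (leq_trans le1).
  have le2 : #|[set w in core (cl u) | L t u w]| <= #|core (cl u)|.
    by apply: subset_leq_card; apply/subsetP=> w; rewrite inE => /andP[].
  apply: subset_leq_card; apply/subsetP=> w; rewrite inE => /andP[wu _].
  by rewrite inE; apply/eqP/clE => //; apply: leq_trans le2.
case/andP: (clP u) => vI thu; case/andP: (clP u') => _; rewrite -uu' => thu'.
(* At least [th] vertices [w'] of the core are linked to [u'], and each reaches [u] through the [th]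
   or more vertices [w] of the core linked to [u], the core being a clique. *)
apply: (@linked_mono G e th t.+2) => //=; apply/orP; right.
apply: leq_trans thu' _; apply: subset_leq_card; apply/subsetP=> w'.
rewrite [_ \in [set _ in _ | _]]inE => /andP[w'core Luw'].
have Lw'u : linked e th t.+1 w' u'.
  by apply: linked_mono (leqnSn t) _; rewrite linked_sym.
rewrite inE; apply/andP; split; last exact: Lw'u.
apply/orP; right; apply: leq_trans thu _; apply: subset_leq_card.
apply/subsetP=> w; rewrite [_ \in [set _ in _ | _]]inE => /andP[wv Luw].
by rewrite inE; apply/andP; split=> //; apply: coreL wv w'core.
Qed.

(** * Counting common neighbours *)

(** There are at least [d * d] walks of length two from [u]; an end in the set receives at most
    [#|G|] of them, any other end at most [e]. *)
Lemma codegree_count (G : sgraph) e d (u : G) :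
  (forall v : G, d <= #|nbhd v|) ->
  d * d <= (#|[set w | e <= #|nbhd u :&: nbhd w|]| + e) * #|G|.
Proof.
move=> dN; set A := [set w | _].
have count : \sum_(x in nbhd u) #|nbhd x| = \sum_w #|nbhd u :&: nbhd w|.
  under eq_bigr do rewrite -sum1_card.
  rewrite (exchange_big_dep xpredT) //=; apply: eq_bigr => w _.
  by rewrite sum1_card; apply: eq_card => x; rewrite unfold_in !inE (adj_sym w).
apply: leq_trans (_ : \sum_(x in nbhd u) #|nbhd x| <= _).
  apply: leq_trans (leq_mul (dN u) (leqnn d)) _.
  by rewrite -sum_nat_const; apply: leq_sum.
rewrite count (bigID (mem A)) /= mulnDl; apply: leq_add.
  by rewrite -sum_nat_const; apply: leq_sum => w _; apply: max_card.
apply: leq_trans (_ : \sum_(w : G) e <= _); last by rewrite sum_nat_const mulnC.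
rewrite big_mkcond; apply: leq_sum => w _; rewrite inE -ltnNge.
by case: ltnP => // /ltnW.
Qed.

(** Adding the vertices of [A] one by one, each new neighbourhood meets the union of the earlier
    ones in at most [e] vertices for each of these. *)
Lemma small_codegree_leq (G : sgraph) e d (A : {set G}) :
  (forall v : G, d <= #|nbhd v|) ->
  {in A &, forall u v, u != v -> #|nbhd u :&: nbhd v| <= e} ->
  #|A| * d <= #|\bigcup_(v in A) nbhd v| + #|A| ^ 2 * e.
Proof.
move=> dN; have [N] := ubnP #|A|; elim: N A => // N IHN A AN Ae.
have [->|[v vA]] := set_0Vmem A; first by rewrite cards0.
have AE : #|A| = #|A :\ v|.+1 by rewrite (cardsD1 v) vA.
have {}IHN := IHN (A :\ v).
have : #|A :\ v| * d <= #|\bigcup_(u in A :\ v) nbhd u| + #|A :\ v| ^ 2 * e.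
  apply: IHN; first by rewrite -ltnS -AE.
  by move=> x y /setD1P[_ xA] /setD1P[_ yA]; apply: Ae.
have -> : \bigcup_(u in A) nbhd u = nbhd v :|: \bigcup_(u in A :\ v) nbhd u.
  by rewrite (big_setD1 v).
have : #|nbhd v :&: \bigcup_(u in A :\ v) nbhd u| <= #|A :\ v| * e.
  rewrite big_distrr /=; apply: leq_card_bigcup => u /setD1P[uv uA].
  by apply: Ae => //; rewrite eq_sym.
have := cardsUI (nbhd v) (\bigcup_(u in A :\ v) nbhd u).
have := dN v; rewrite AE; nia.
Qed.

(** The neighbourhoods of any [c.+1] such vertices would cover more than [#|G|] vertices. This
    bounds the sets of pairwise unlinked vertices. *)
Lemma small_codegree_bound (G : sgraph) e d c (A : {set G}) :
  (forall v : G, d <= #|nbhd v|) -> #|G| + c.+1 ^ 2 * e < c.+1 * d ->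
  {in A &, forall u v, u != v -> #|nbhd u :&: nbhd v| <= e} -> #|A| <= c.
Proof.
move=> dN lt Ae; rewrite leqNgt; apply/negP => cA.
have [B sBA Bc] := subset_of_card cA.
have := @small_codegree_leq G e d B dN _; rewrite Bc => /(_ _)H.
have leG : #|\bigcup_(v in B) nbhd v| <= #|G| := max_card _.
suff : c.+1 * d <= #|\bigcup_(v in B) nbhd v| + c.+1 ^ 2 * e by lia.
by apply: H => x y xB yB; apply: Ae; apply: (subsetP sBA).
Qed.

Definition exchangeable (G : sgraph) k w s (u v : G) : Prop :=
  forall W : {set G}, #|W| <= w ->
    exists S : {set G}, [/\ [disjoint S & W], #|S| <= s & exchanger k u v S].

(** [Q] is paired off with [Y] and disjoint exchangers are taken for the pairs. Each pair costs [s]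
    vertices for its exchanger and 2 for itself, hence [s + 2]. *)
Lemma exchange_sets (G : sgraph) k w s (Q Y W : {set G}) :
  #|Q| = #|Y| -> [disjoint Q & Y] ->
  {in Q & Y, forall x y, exchangeable k w s x y} ->
  #|W| + #|Q| * (s + 2) <= w ->
  exists A : {set G},
    [/\ [disjoint A & W :|: (Q :|: Y)], #|A| <= #|Q| * s,
        tileable k (A :|: Q) & tileable k (A :|: Y)].
Proof.
have [N] := ubnP #|Q|; elim: N Q Y W => // N IHN Q Y W QN QY dQY ex Ww.
have [Q0|[x xQ]] := set_0Vmem Q.
  have Y0 : Y = set0 by apply/eqP; rewrite -cards_eq0 -QY Q0 cards0.
  exists set0; rewrite Q0 Y0 !setU0 cards0; split=> //; try constructor.
  by rewrite -setI_eq0 set0I.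
have [y yY] : exists y, y \in Y by apply/card_gt0P; rewrite -QY (cardsD1 x) xQ.
have QE : #|Q| = #|Q :\ x|.+1 by rewrite (cardsD1 x) xQ.
have YE : #|Y| = #|Y :\ y|.+1 by rewrite (cardsD1 y) yY.
have [|||||A [dA sA tAQ tAY]] := IHN (Q :\ x) (Y :\ y) (W :|: [set x; y]).
- by rewrite -ltnS -QE.
- by have := QY; rewrite QE YE => -[].
- by apply: disjointWl (subD1set _ _) _; apply: disjointWr (subD1set _ _) _.
- by move=> u v /setD1P[_ uQ] /setD1P[_ vY]; apply: ex.
- by have := leq_cardsU W [set x; y]; have := cards2_leq x y; nia.
have [|S [dS sS [xS yS tx ty]]] := ex x y xQ yY (W :|: (Q :|: Y) :|: A).
  have := leq_cardsU (W :|: (Q :|: Y)) A; have := leq_cardsU W (Q :|: Y).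
  by have := leq_cardsU Q Y; nia.
move: dA; rewrite !disjointsUr.
case/andP=> /andP[dAW /andP[dAx dAy]] /andP[dAQ dAY].
move: dS; rewrite !disjointsUr => /andP[/andP[dSW /andP[dSQ dSY]] dSA].
have split1 (R : {set G}) (z : G) : z \in R -> [disjoint S & R] ->
    [disjoint A & [set z]] -> tileable k (A :|: R :\ z) ->
    tileable k (z |: S) -> tileable k ((A :|: S) :|: R).
  move=> zR dSR dAz tA tz.
  rewrite (_ : A :|: S :|: R = (A :|: R :\ z) :|: (z |: S)); last first.
    apply/setP=> v; rewrite !inE; case: eqVneq => [->|_] /=.
      by rewrite zR !orbT.
    by case: (v \in A); case: (v \in S); case: (v \in R).
  apply: tileableU => //; apply/disjointsP=> v /setUP[vA|/setD1P[vz vR]].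
    case/setU1P=> [vz|vS]; first by rewrite vz (disjointFl dAz) ?inE in vA.
    by rewrite (disjointFr dSA vS) in vA.
    case/setU1P=> [vz'|vS]; first by rewrite vz' eqxx in vz.
    by rewrite (disjointFr dSR vS) in vR.
exists (A :|: S); split.
- rewrite !disjointsUr; apply/and3P; split; apply/disjointsP=> v /setUP[vA|vS] vR.
  + by rewrite (disjointFr dAW vA) in vR.
  + by rewrite (disjointFr dSW vS) in vR.
  + have [vx|vx] := eqVneq v x; first by rewrite vx (disjointFl dAx) ?inE in vA.
    by rewrite (disjointFl dAQ) // in_setD1 vx in vA.
  + by rewrite (disjointFr dSQ vS) in vR.
  + have [vy|vy] := eqVneq v y; first by rewrite vy (disjointFl dAy) ?inE in vA.
    by rewrite (disjointFl dAY) // in_setD1 vy in vA.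
  + by rewrite (disjointFr dSY vS) in vR.
- by rewrite (leq_trans (leq_cardsU _ _)) // QE mulSn addnC leq_add.
- exact: split1 tx.
- exact: split1 ty.
Qed.

(** * Absorbers *)

(** [Q] is exchanged with a [k]-clique [Y] of [C] through a set [A]. Then [A :|: Y] is tileable, and
    [A :|: Y :|: Q] splits into [A :|: Q] and the clique [Y]. *)
Lemma absorber (G : sgraph) k a w s (C Q W : {set G}) :
  clique_rich G k a -> {in C &, forall x y, exchangeable k w s x y} ->
  Q \subset C -> #|Q| = k -> #|W| + k + a < #|C| -> #|W| + k * (s + 2) <= w ->
  exists A : {set G}, [/\ [disjoint A & W], #|A| <= k * (s + 1),
    tileable k A, [disjoint A & Q] & tileable k (A :|: Q)].
Proof.
move=> rich ex sQC Qk WC Ww.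
have [|Y sY cY] := rich (C :\: (W :|: Q)).
  have := cardsID (W :|: Q) C; have := leq_cardsU W Q.
  by have := subset_leq_card (subsetIr C (W :|: Q)); lia.
have [Yk _] := kcliqueP cY; move: sY; rewrite subsetD disjointsUr.
case/andP=> sYC /andP[dYW dYQ].
have [||||A [dA sA tAQ tAY]] := @exchange_sets G k w s Q Y W.
- by rewrite Qk Yk.
- by rewrite disjoint_sym.
- by move=> x y xQ yY; apply: ex; [apply: (subsetP sQC)|apply: (subsetP sYC)].
- by rewrite Qk.
move: dA; rewrite !disjointsUr => /and3P[dAW dAQ dAY].
exists (A :|: Y); split=> //.
- by rewrite disjoint_sym disjointsUr !(disjoint_sym W) dAW.
- by rewrite (leq_trans (leq_cardsU _ _)) // mulnDr muln1 Yk leq_add -?Qk.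
- by rewrite disjoint_sym disjointsUr !(disjoint_sym Q) dAQ.
rewrite setUAC; apply: tileableU tAQ (tileable_clique cY).
by rewrite disjoint_sym disjointsUr (disjoint_sym Y A) dAY.
Qed.

(* Each vertex [z] of the template carries a set [Q z] of [k.-1] vertices and
   each edge [(z, x)] an absorber for [x |: Q z]. A perfect matching tells which
   absorbers are used; the others tile themselves. *)
Lemma class_absorber (G : sgraph) k a w s m (C X0 W : {set G}) :
  0 < k -> clique_rich G k a ->
  {in C &, forall x y, exchangeable k w s x y} ->
  X0 \subset C -> #|X0| <= 4 * m ->
  #|W| + a + 250 * (k * (s + 2) * m) < #|C| ->
  #|W| + 250 * (k * (s + 2) * m) <= w ->
  exists A : {set G}, [/\ [disjoint A & W :|: X0],
    #|A| <= 250 * (k * (s + 2) * m)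
  & forall X' : {set G}, X' \subset X0 -> #|X'| = m -> tileable k (A :|: X')].
Proof.
move=> k_gt0 rich ex sX0C X0m WC Ww.
have [m0|m_gt0] := posnP m.
  exists set0; rewrite m0 muln0 cards0; split=> // [|X' _ /eqP].
    by rewrite -setI_eq0 set0I.
  by rewrite cards_eq0 => /eqP->; rewrite setU0; constructor.
set b := k * (s + 2) in WC Ww *; set B := b * m in WC Ww *.
have kB : 2 * (k * m) <= B by rewrite mulnCA mulnA leq_mul2r leq_mul2l leq_addl !orbT.
have mK : m <= k * m by rewrite -[leqLHS]mul1n leq_mul2r k_gt0 orbT.
have kK : k <= k * m by rewrite -[leqLHS]muln1 leq_mul2l m_gt0 orbT.
have bB : b <= B by rewrite -[leqLHS]muln1 leq_mul2l m_gt0 orbT.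
have cap (U : {set G}) l : #|U| <= #|W| + 249 * B -> l <= B ->
    exists2 Y : {set G}, Y \subset C & [disjoint Y & U] /\ #|Y| = l.
  move=> Us lb; have [|Y sY Yl] := @subset_of_card _ (C :\: U) l.
    have := cardsID U C; have := subset_leq_card (subsetIr C U).
    by lia.
  by move: sY; rewrite subsetD => /andP[? ?]; exists Y.
(* [Y] is the part of the template covered by every matching, [X0] the flexible part. *)
have [||Y sYC [dY Ym]] := cap (W :|: X0) (2 * m).
- have := leq_cardsU W X0; lia.
- by lia.
pose W1 := W :|: X0 :|: Y.
have W1s : #|W1| <= #|W| + 6 * m.
  by have := leq_cardsU (W :|: X0) Y; have := leq_cardsU W X0; rewrite /W1; lia.
have [||Q [QP _ dQW dQQ]] := @greedy_disjoint 'I_(3 * m) G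
  (fun _ A => A \subset C /\ #|A| = k.-1) k (#|W| + 6 * m + 3 * (k * m)) W1.
- move=> z U Us; have [||A sAC [dA Ak]] := cap U k.-1; [by lia..|].
  by exists A; split=> //; rewrite Ak leq_pred.
- by rewrite card_ord; lia.
pose QQ := \bigcup_z Q z.
have QQs : #|QQ| <= 3 * (k * m).
  have := @leq_card_bigcup _ _ xpredT Q k; rewrite card_ord (mulnC k) mulnA; apply=> z _.
  by case: (QP z) => _ ->; apply: leq_pred.
pose XT : finType := {x | x \in X0}; pose YT : finType := {x | x \in Y}.
have [|||T [zof [bof [Ts tau]]]] := @robustly_matchable XT YT 'I_(3 * m) m.
- by rewrite card_sig.
- by rewrite card_sig.
- by rewrite card_ord.
have Tb : #|T| * b <= 207 * B by rewrite /B (mulnC b) mulnA leq_mul2r Ts orbT.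
pose vb (p : XT + YT) : G := match p with inl x => val x | inr y => val y end.
have vbX x : vb (inl x) \in X0 := valP x.
have vbY y : vb (inr y) \in Y := valP y.
have vbXY p : vb p \in X0 :|: Y.
  by case: p => p; rewrite inE /= (valP p) ?orbT.
have vb_inj : injective vb.
  move=> [x|x] [y|y] exy.
  - by congr inl; apply: val_inj.
  - by have := disjointFr dY (vbY y); rewrite -exy inE vbX orbT.
  - by have := disjointFr dY (vbY x); rewrite exy inE vbX orbT.
  - by congr inr; apply: val_inj.
have vbQ p z : vb p \notin Q z.
  apply/negP => pQ; have := disjointFr (dQW z) pQ; rewrite /W1 -setUA inE.
  by rewrite vbXY orbT.
pose Qt t := vb (bof t) |: Q (zof t).
have QtC t : Qt t \subset C.
  rewrite subUset sub1set (QP _).1 andbT.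
  by apply: subsetP (vbXY _); rewrite subUset sX0C.
have Qtk t : #|Qt t| = k by rewrite cardsU1 vbQ (QP _).2 add1n prednK.
have [||A [AP As dAW dAA]] := @greedy_disjoint T G
  (fun t A => tileable k A /\ tileable k (A :|: Qt t)) b
  (#|W| + 240 * B) (W1 :|: QQ).
- move=> t U Us; have [||||A [dA sA tA _ tAQ]] := @absorber G k a w s C (Qt t) U rich ex.
  + exact: QtC.
  + exact: Qtk.
  + by lia.
  + by lia.
  by exists A; split=> //; rewrite (leq_trans sA) // leq_mul2l leq_add2l orbT.
- by have := leq_cardsU W1 QQ; lia.
have dA0 t x : x \in A t -> (x \notin W :|: X0 :|: Y) && (x \notin QQ).
  move=> xA; have := disjointFr (dAW t) xA.
  by rewrite !in_setU => /negbT; rewrite !negb_or.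
(* The absorbers take at most [207 * B] vertices, [Y] at most [B] and [QQ] at most [2 * B], which is
   within [250 * B]. *)
exists (Y :|: QQ :|: \bigcup_t A t); split.
- apply/disjointsP=> x; rewrite !in_setU -orbA => /or3P[xY|xQ|/bigcupP[t _ xA]].
  + by have := disjointFr dY xY; rewrite in_setU => ->.
  + have /bigcupP[z _ xQz] := xQ; have := disjointFr (dQW z) xQz.
    by rewrite !in_setU => /norP[/negbTE->].
  + have := dA0 t x xA; rewrite !in_setU !negb_or.
    by case/andP=> /andP[/andP[/negPf-> /negPf->]].
- have := leq_cardsU (Y :|: QQ) (\bigcup_t A t); have := leq_cardsU Y QQ.
  have leA : #|\bigcup_t A t| <= #|T| * b := leq_card_bigcup (fun t _ => As t).
  by lia.
move=> X' sX' X'm.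
have [|tau' tauK [taui tauc]] := tau [set x | val x \in X'].
  rewrite -X'm -(card_imset _ val_inj); apply: eq_card => x.
  apply/imsetP/idP => [[y]|xX']; first by rewrite inE => ? ->.
  by exists (Sub x (subsetP sX' x xX')); rewrite ?inE SubK.
have notQt t x : x \in A t -> forall t', x \in Qt t' -> False.
  move=> /dA0/andP[xW xQQ] t' /setU1P[xv|xQ].
    move: xW (vbXY (bof t')); rewrite -xv !in_setU !negb_or.
    by case/andP=> /andP[_ /negPf->] /negPf->.
  by case/negP: xQQ; apply/bigcupP; exists (zof t').
(* Edge [t] is in the matching exactly when [tau'] sends its end [zof t] to [t]; its absorber then
   takes in [Qt t]. *)
pose F t := A t :|: (if tau' (zof t) == t then Qt t else set0).
rewrite (_ : _ :|: X' = \bigcup_t F t).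
  apply: tileable_bigcup => [t|t t' tt'].
    by rewrite /F; case: eqP => _; rewrite ?setU0; case: (AP t).
  apply/disjointsP=> x /setUP[xA|xQ] /setUP[xA'|xQ'].
  - by rewrite (disjointFr (dAA t t' tt') xA) in xA'.
  - by move: xQ'; case: ifP => _; [move/(notQt _ _ xA)|rewrite inE].
  - by move: xQ; case: ifP => _; [move/(notQt _ _ xA')|rewrite inE].
  - case: eqP xQ => [tt|_]; last by rewrite inE.
    case: eqP xQ' => [tt1|_]; last by rewrite inE.
    have zz' : zof t != zof t' by apply: contraNneq tt' => e; rewrite -tt -tt1 e.
    move=> /setU1P[->|xQ'] /setU1P[|xQ].
    + move/vb_inj; rewrite -tt -tt1 => e.
      by case/eqP: zz'; apply: taui.
    + by rewrite (negPf (vbQ _ _)) in xQ.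
    + by move=> e; rewrite e (negPf (vbQ _ _)) in xQ'.
    + by rewrite (disjointFr (dQQ _ _ zz') xQ) in xQ'.
apply/setP=> x; apply/idP/bigcupP.
  have inF z : Qt (tau' z) \subset F (tau' z).
    by rewrite /F tauK eqxx subsetUr.
  have inFb p : p \in codom (bof \o tau') -> exists2 t, true & vb p \in F t.
    case/codomP=> z pz; exists (tau' z) => //; apply: (subsetP (inF z)).
    by rewrite pz setU11.
  rewrite !in_setU -!orbA => /or4P[xY|/bigcupP[z _ xQ]|/bigcupP[t _ xA]|xX'].
  - by apply: (inFb (inr (Sub x xY))); rewrite tauc.
  - exists (tau' z) => //; apply: (subsetP (inF z)).
    by rewrite /Qt tauK in_setU1 xQ orbT.
  - by exists t => //; rewrite /F in_setU xA.
  - by apply: (inFb (inl (Sub x (subsetP sX' x xX')))); rewrite tauc inE.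
case=> t _; rewrite /F !in_setU -!orbA => /orP[xA|].
  by apply/or4P/Or43; apply/bigcupP; exists t.
case: eqP => [tt|_]; last by rewrite inE.
case/setU1P=> [->|xQ]; last by apply/or4P/Or42; apply/bigcupP; exists (zof t).
have := tauc (bof t); rewrite -{1}tt (codom_f (bof \o tau') (zof t)).
case: (bof t) => [y|y].
  by rewrite inE => yX'; apply/or4P/Or44.
by move=> _; apply/or4P/Or41; apply: vbY.
Qed.

(** * Assembling the tiling *)

(** Each vertex of [U] in turn joins [k.-1] of its neighbours in [X]. The earlier ones have used at
    most [k] vertices each, so more than [a] neighbours remain for the next clique. *)
Lemma absorb_leftover (G : sgraph) k a m (X U : {set G}) :
  0 < k -> clique_rich G k a -> (forall u, m <= #|nbhd u :&: X|) ->
  [disjoint U & X] -> k * #|U| + a <= m ->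
  exists X1 : {set G},
    [/\ X1 \subset X, #|X1| <= k * #|U| & tileable k (U :|: X1)].
Proof.
move=> k_gt0 rich mX; have [N] := ubnP #|U|; elim: N U => // N IHN U UN dUX Um.
have [->|[u uU]] := set_0Vmem U.
  by exists set0; rewrite sub0set cards0 setU0; split=> //; constructor.
have UE : #|U| = #|U :\ u|.+1 by rewrite (cardsD1 u) uU.
have [|||X1 [sX1 X1s tX1]] := IHN (U :\ u).
- by rewrite -ltnS -UE.
- exact: disjointWl (subD1set _ _) dUX.
- by move: Um; rewrite UE mulnS; lia.
have [|K] := rich ((nbhd u :&: X) :\: X1).
  have := cardsID X1 (nbhd u :&: X); have := mX u.
  have := subset_leq_card (subsetIr (nbhd u :&: X) X1).
  by move: Um; rewrite UE mulnS; lia.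
rewrite subsetD subsetI => /andP[/andP[Ku KX] dKX1] cK.
have [Kk _] := kcliqueP cK.
have [x xK] : exists x, x \in K by apply/card_gt0P; rewrite Kk.
have [_ cKu] := cliqueD1_nbhd cK xK Ku.
have KxX : K :\ x \subset X := subset_trans (subD1set _ _) KX.
exists (K :\ x :|: X1); split; first by rewrite subUset KxX.
  rewrite (leq_trans (leq_cardsU _ _)) // UE mulnS leq_add //.
  by rewrite -Kk subset_leq_card ?subD1set.
rewrite -(setD1K uU) setUACA; apply: tileable_add => //.
rewrite disjointsUr; apply/andP; split; apply/disjointsP=> y /setU1P[->|yK].
- by rewrite setD11.
- by case/setD1P=> _ yU; have := subsetP KxX y yK; rewrite (disjointFr dUX yU).
- by move=> uX1; have := disjointFr dUX uU; rewrite (subsetP sX1 _ uX1).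
- by case/setD1P: yK => _ yK yX1; rewrite (disjointFr dKX1 yK) in yX1.
Qed.

(** Cliques are removed while more than [m + k.-1] vertices remain; each takes [k], so the size
    never drops below [m]. *)
Lemma tile_down_to (G : sgraph) k a m (Z : {set G}) :
  0 < k -> clique_rich G k a -> a <= m -> m <= #|Z| ->
  exists A : {set G}, [/\ A \subset Z, tileable k A,
    m <= #|Z :\: A| & #|Z :\: A| <= m + k.-1].
Proof.
move=> k_gt0 rich am; have [N] := ubnP #|Z|; elim: N Z => // N IHN Z ZN mZ.
have [Zm|Zm] := leqP #|Z| (m + k.-1).
  by exists set0; rewrite sub0set setD0; split=> //; constructor.
have [|K sKZ cK] := rich Z; first by lia.
have [Kk _] := kcliqueP cK.
have [||A [sA tA mA Am]] := IHN (Z :\: K); try by rewrite cardsDS // Kk; lia.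
move: sA; rewrite subsetD => /andP[sAZ dAK].
exists (K :|: A); rewrite -setDDl subUset sKZ; split=> //.
by apply: tileable_add => //; rewrite disjoint_sym.
Qed.

Lemma almost_tiling_of_classes (G : sgraph) k c a w s th mX (X : {set G}) (cl : G -> G) :
  0 < k -> clique_rich G k a ->
  #|cl @: setT| <= c ->
  (forall u v, cl u = cl v -> exchangeable k w s u v) ->
  (forall u, th <= #|[set v | cl v == cl u]|) ->
  (forall u, mX <= #|nbhd u :&: X|) ->
  (forall u, mX <= #|[set v | cl v == cl u] :&: X|) ->
  2 * (k * a) + a < mX ->
  #|X| + c.+1 * (250 * (k * (s + 2) * #|X|)) + a < th ->
  #|X| + c.+1 * (250 * (k * (s + 2) * #|X|)) <= w ->
  exists2 A : {set G}, tileable k A & #|~: A| <= c * k.-1.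
Proof.
move=> k_gt0 rich clc ex clth NX CX amX Xth Xw.
pose I : finType := {v | v \in cl @: setT}.
have Ic : #|I| <= c by rewrite card_sig.
pose C (v : I) := [set u | cl u == val v].
have CE (v : I) : exists u, val v = cl u.
  have vI : val v \in cl @: setT := valP v.
  by case/imsetP: vI => u _ e; exists u.
have CX' v : mX <= #|X :&: C v|.
  by rewrite setIC /C; case: (CE v) => u ->.
have thC v : th <= #|C v| by rewrite /C; case: (CE v) => u ->.
(* Covering the leftover vertices will consume at most [k * a] vertices of [X], so at least [m v]
   survive in each part. *)
pose m v := #|X :&: C v| - k * a.
have leX v : #|X :&: C v| <= #|X| := subset_leq_card (subsetIl _ _).
set b := 250 * (k * (s + 2) * #|X|) in Xth Xw.
have bm v : 250 * (k * (s + 2) * m v) <= b.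
  by rewrite leq_mul2l leq_mul // (leq_trans (leq_subr _ _)) ?leX ?orbT.
rewrite mulSn in Xth Xw.
have [||A [AP _ dAX dAA]] := @greedy_disjoint I G
  (fun v A => forall X' : {set G}, X' \subset X :&: C v -> #|X'| = m v ->
     tileable k (A :|: X')) b (#|X| + c * b) X.
- move=> v U Us.
  have [|||||A [dA sA AP]] := @class_absorber G k a w s (m v) (C v)
    (X :&: C v) (U :\: (X :&: C v)) k_gt0 rich.
  + by move=> x y; rewrite !inE => /eqP xv /eqP yv; apply: ex; rewrite xv yv.
  + exact: subsetIr.
  + by have := CX' v; rewrite /m; lia.
  + by move: Us (bm v) (subset_leq_card (subsetDl U (X :&: C v))) (thC v); lia.
  + by move: Us (bm v) (subset_leq_card (subsetDl U (X :&: C v))); lia.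
  exists A; split=> //; last exact: leq_trans sA (bm v).
  apply: disjointWr dA; apply/subsetP=> x xU; rewrite in_setU in_setD xU andbT.
  by rewrite orNb.
- by rewrite leq_add2l leq_mul2r Ic orbT.
pose AA := \bigcup_v A v; pose R := ~: (X :|: AA).
(* At most [a] vertices outside [X] and the absorbers escape the greedy tiling; cliques using [X1]
   take them in. *)
have [A0 [sA0 tA0 RA0]] := tile_greedy R k_gt0 rich.
have [||X1 [sX1 X1s tX1]] := @absorb_leftover G k a mX X (R :\: A0) k_gt0 rich NX.
- apply/disjointsP=> x /setDP[]; rewrite in_setC in_setU negb_or.
  by case/andP=> /negP.
- have : k * #|R :\: A0| <= k * a by rewrite leq_mul2l RA0 orbT.
  by lia.
(* In each class [Y.1] is tiled by itself, [Y.2] has the prescribed size and goes to the absorber,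
   and at most [k.-1] vertices of the part are lost. *)
have /fin_all_exists[Y YP] v : exists Y : {set G} * {set G},
    [/\ Y.1 \subset (X :&: C v) :\: X1, tileable k Y.1,
        Y.2 \subset (X :&: C v) :\: X1 :\: Y.1, #|Y.2| = m v &
        #|(X :&: C v) :\: X1 :\: Y.1| <= m v + k.-1].
  have [||Y1 [sY1 tY1 mY1 Y1m]] :=
    @tile_down_to G k a (m v) ((X :&: C v) :\: X1) k_gt0 rich.
  - by have := CX' v; rewrite /m; lia.
  - have := cardsID X1 (X :&: C v); have := subset_leq_card (subsetIr (X :&: C v) X1).
    have : k * #|R :\: A0| <= k * a by rewrite leq_mul2l RA0 orbT.
    by rewrite /m; lia.
  have [Y2 sY2 Y2m] := subset_of_card mY1.
  by exists (Y1, Y2); split.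
pose F v := (A v :|: (Y v).2) :|: (Y v).1.
exists ((A0 :|: ((R :\: A0) :|: X1)) :|: \bigcup_v F v).
  have RX x : x \in R -> x \notin X /\ forall v, x \notin A v.
    rewrite !inE negb_or => /andP[-> xAA]; split=> // v.
    by apply: contra xAA => xA; apply/bigcupP; exists v.
  have X1A v : [disjoint X1 & A v] by apply: disjointWl sX1 _; rewrite disjoint_sym.
  have FX v x : x \in F v -> [|| x \in A v | (x \in X :&: C v) && (x \notin X1)].
    case: (YP v) => /subsetP sY1 _ /subsetP sY2 _ _.
    rewrite /F !in_setU -orbA => /or3P[->//|/sY2|/sY1].
      by case/setDP=> /setDP[-> ->]; rewrite orbT.
    by case/setDP=> -> ->; rewrite orbT.
  apply: tileableU; [|apply: tileableU => //|apply: tileable_bigcup].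
  - apply: disjoint_bigcupr => v _; apply/disjointsP=> x.
    case/setUP=> [/(subsetP sA0)/RX[xX xA]|/setUP[/setDP[/RX[xX xA] _]|xX1]] /FX.
    + by rewrite (negPf (xA v)) in_setI (negPf xX).
    + by rewrite (negPf (xA v)) in_setI (negPf xX).
    + by rewrite xX1 andbF orbF (disjointFr (X1A v) xX1).
  - apply/disjointsP=> x xA0; rewrite !inE xA0 /= => xX1.
    by have [] := RX x (subsetP sA0 x xA0); rewrite (subsetP sX1).
  - move=> v; case: (YP v) => sY1 tY1 sY2 Y2m _.
    apply: tileableU => //.
      apply/disjointsP=> x /setUP[xA|/(subsetP sY2)/setDP[_ /negP]//].
      move/(subsetP sY1)/setDP=> -[/setIP[xX _] _].
      by rewrite (disjointFr (dAX v) xA) in xX.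
    apply: AP => //; apply: subset_trans sY2 _.
    by apply: subset_trans (subsetDl _ _) (subsetDl _ _).
  - move=> v v' vv'; apply/disjointsP=> x.
    move=> /FX/orP[xA|/andP[xC _]] /FX/orP[xA'|/andP[xC' _]].
    + by rewrite (disjointFr (dAA _ _ vv') xA) in xA'.
    + by move: xC'; rewrite in_setI (disjointFr (dAX v) xA).
    + by move: xC; rewrite in_setI (disjointFr (dAX v') xA').
    + move: xC xC'; rewrite !inE => /andP[_ /eqP->] /andP[_ /eqP/val_inj e].
      by rewrite e eqxx in vv'.

apply: leq_trans (_ : #|\bigcup_v (((X :&: C v) :\: X1 :\: (Y v).1) :\: (Y v).2)| <= _).
  apply: subset_leq_card; apply/subsetP=> x; rewrite in_setC => xA.
  move: xA; rewrite 2!in_setU !negb_or in_setU negb_or.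
  case/andP=> /and3P[xA0 xU xX1] xF.
  have xFv v : x \notin F v by apply: contra xF => xF; apply/bigcupP; exists v.
  have xR : x \notin R by apply: contra xU => xR; rewrite in_setD xA0.
  have xX : x \in X.
    move: xR; rewrite in_setC negbK in_setU => /orP[//|/bigcupP[v _ xA]].
    by have := xFv v; rewrite /F !in_setU xA.
  have vI : cl x \in cl @: setT by apply: imset_f.
  apply/bigcupP; exists (Sub (cl x) vI : I) => //; move: (xFv (Sub (cl x) vI)).
  rewrite /F !in_setU !negb_or => /andP[/andP[_ xY2] xY1].
  by rewrite !in_setD xY2 xY1 xX1 in_setI xX inE SubK eqxx.
have le v : #|((X :&: C v) :\: X1 :\: (Y v).1) :\: (Y v).2| <= k.-1.
  by case: (YP v) => _ _ sY2 Y2m Ym; rewrite cardsDS // Y2m leq_subLR.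
apply: leq_trans (leq_card_bigcup (fun v _ => le v)) _.
by rewrite leq_mul2r Ic orbT.
Qed.

(** * Choice of the constants *)

(** The power is at least the square of [j.+1], with [j] about [n / (2 * P)], which outgrows
    [2 * n]. This permits [uniform_hitting] for [2 * n] sets with linearly many hits. *)
Lemma linear_lt_exp P n : 8 * P * P <= n -> 0 < P -> 2 * n < 2 ^ (n %/ P).
Proof.
move=> Pn P_gt0; set m := n %/ P; set j := m %/ 2.
have nm : n < m.+1 * P by rewrite ltn_ceil.
have m8 : 8 * P <= m by rewrite leq_divRL.
have mj : m < j.+1 * 2 by rewrite ltn_ceil.
have jm : j * 2 <= m by rewrite leq_trunc_div.
have j2 : j.+1 ^ 2 <= 2 ^ m.
  apply: leq_trans (_ : 2 ^ (j * 2) <= _); last by rewrite leq_exp2l.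
  by rewrite expnM leq_exp2r // ltn_expl.
apply: leq_trans j2; have : 4 * P <= j.+1 by lia.
have : 2 * n < 2 * (m.+1 * P) by rewrite ltn_mul2l.
have : 2 * (m.+1 * P) <= 4 * P * j.+1 by nia.
rewrite -mulnn => l1 l2 l3; apply: leq_trans l2 _; apply: leq_trans l1 _.
by rewrite leq_mul2r l3 orbT.
Qed.

(** A version over the natural numbers: [M] records the slack in (c + 1) d >= (1 + 1/M) n, and 1/N
    will be the constant alpha. *)
Lemma almost_tiling k c M : 0 < k -> 0 < c -> 0 < M ->
  exists N n0 : nat, 0 < N /\ forall (G : sgraph) (d a : nat), n0 <= #|G| ->
    (forall v : G, d <= #|nbhd v|) -> M.+1 * #|G| <= M * (c.+1 * d) ->
    clique_rich G k a -> N * a <= #|G| ->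
    exists2 A : {set G}, tileable k A & #|~: A| <= c * k.-1.
Proof.
move=> k_gt0 c_gt0 M_gt0.
(* [s] bounds an exchanger at level [c.+2], [#|G| %/ B] is the threshold for being linked,
   [#|G| %/ P] the number of hits, and [K * #|X|] bounds the room for [X] and all absorbers; [P]
   keeps this within [#|G|] over [4 * B]. *)
pose s := k * 2 ^ c.+2; pose B := 4 * M * c.+1 ^ 4.
pose K := 1 + c.+1 * (250 * (k * (s + 2))); pose P := 48 * K * (2 * B) * B.
have c4 : 0 < c.+1 ^ 4 by rewrite expn_gt0.
have B_gt0 : 0 < B by rewrite /B; move: (c.+1 ^ 4) c4; nia.
have K_gt0 : 0 < K by rewrite /K add1n.
have sE : s = k * 2 ^ c.+2 by [].
have BE : B = 4 * M * c.+1 ^ 4 by [].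
have PE : P = 48 * K * (2 * B) * B by [].
have KE : K = 1 + c.+1 * (250 * (k * (s + 2))) by [].
clearbody s K; clearbody B; clearbody P.
have KB_gt0 : 0 < K * B by rewrite muln_gt0 K_gt0.
have P_gt0 : 0 < P by move: (K * B) KB_gt0 PE B_gt0; nia.
have BP : 48 * B <= P by rewrite PE; nia.
exists (8 * k * P), (8 * P * P + 64 * B * s + 4 * B + 1).
split=> [|G d a n0 dN deg rich Na]; first by rewrite !muln_gt0 k_gt0.
have [nP nBs nB n_gt0] : [/\ 8 * P * P <= #|G|, 64 * B * s <= #|G|,
    4 * B <= #|G| & 0 < #|G|] by split; clear -n0; lia.
set n := #|G| in n0 deg Na nP nBs nB n_gt0 *; pose th := n %/ B; pose m := n %/ P.
have thn : th * B <= n by rewrite leq_trunc_div.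
have nth : n < th.+1 * B by rewrite ltn_ceil.
have mn : m * P <= n by rewrite leq_trunc_div.
have nm : n < m.+1 * P by rewrite ltn_ceil.
have th_gt0 : 0 < th by rewrite divn_gt0 //; clear -nB; lia.
have m_gt0 : 0 < m.
  by rewrite divn_gt0 // (leq_trans _ nP) // -mulnA mulnCA leq_pmulr // muln_gt0.
have n2m : 2 * n < 2 ^ m by apply: linear_lt_exp.
clearbody th m.
have cd : n <= c.+1 * d.
  rewrite -(leq_pmul2l M_gt0); apply: leq_trans deg; rewrite leq_mul2r leqnSn orbT.
  by [].
have Mth : 4 * (M * (c.+1 ^ 4 * th)) <= n.
  by apply: leq_trans thn; rewrite BE [leqRHS]mulnC !mulnA.
have c2c4 : c.+1 ^ 2 <= c.+1 ^ 4 by rewrite leq_exp2l.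
have c1c2 : c.+1 <= c.+1 ^ 2 by rewrite -mulnn leq_pmulr.
have Mth2 : 4 * (M * (c.+1 ^ 2 * th)) <= n.
  by apply: leq_trans Mth; rewrite !leq_mul2l leq_mul2r c2c4 !orbT.
have cth2 : 4 * (c.+1 ^ 2 * th) <= n.
  by apply: leq_trans Mth2; rewrite leq_mul2l leq_pmull.
have thd : th <= d.
  rewrite -(leq_pmul2l (ltn0Sn c)); apply: leq_trans cd; apply: leq_trans cth2.
  apply: leq_trans (_ : c.+1 ^ 2 * th <= _); first by rewrite leq_mul2r c1c2 orbT.
  by rewrite leq_pmull.
have [||| I [cl [Ic clI clth clL]]] := @closed_classes G th th c.
(* Unlinked vertices have codegree below [th], and the slack 1/M pays for the error
   [c.+1 ^ 2 * th]. *)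
- move=> A Aind; apply: (@small_codegree_bound G th d c) => //.
    rewrite -/n -(ltn_pmul2l M_gt0); apply: leq_trans deg.
    by rewrite mulnDr; clear -Mth2 n_gt0; move: (c.+1 ^ 2 * th) Mth2; lia.
  by move=> u v uA vA uv; have := Aind u v uA vA uv; rewrite /= -ltnNge => /ltnW.
- by move=> u; apply: leq_trans thd (dN u).
(* Squaring [n <= c.+1 * d] turns the walk count into [n <= c.+1 ^ 2 * (L + th)], so [L] exceeds
   [(c * c + c) * th]. *)
- move=> u; have := @codegree_count G th d u dN; rewrite -/n /=.
  set L := #|_|; move: L => L dL.
  have nL : n <= c.+1 ^ 2 * (L + th).
    rewrite -(leq_pmul2l n_gt0); apply: leq_trans (_ : (c.+1 * d) * (c.+1 * d) <= _).
      exact: leq_mul.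
    rewrite mulnACA mulnn (mulnC n) -mulnA leq_mul2l dL orbT.
    by [].
  rewrite ltnNge; apply/negP => Lc.
  have cL : c.+1 ^ 2 * L <= c.+1 ^ 4 * th.
    rewrite (expnD _ 2 2) -mulnA leq_mul2l (leq_trans Lc) ?orbT // leq_mul2r.
    by rewrite -mulnn mulSn mulnS; apply/orP; right; clear; lia.
  have Mth1 : 4 * (c.+1 ^ 4 * th) <= n.
    by apply: leq_trans Mth; rewrite leq_mul2l leq_pmull.
  move: nL; rewrite mulnDr => nL; clear -nL cL Mth1 cth2 n_gt0.
  by move: (c.+1 ^ 2 * L) (c.+1 ^ 2 * th) (c.+1 ^ 4 * th) nL cL Mth1 cth2; lia.
(* Neighbourhoods and classes form one family of [2 * n] sets of size at least [th], hence at least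
   [n] over [2 * B]. *)
pose F (i : G + G) := match i with
  | inl u => nbhd u | inr u => [set v | cl v == cl u] end.
have thF i : th <= #|F i| by case: i => u /=; [apply: leq_trans thd (dN u)|].
have [||||X Xs FX] := @uniform_hitting (G + G)%type G F (2 * B) m.
- by rewrite muln_gt0.
- by move=> i; have := thF i; rewrite -/n; move: (#|F i|) => f; clear -nth th_gt0; nia.
- apply: leq_trans mn; rewrite mulnC leq_mul2l PE; apply/orP; right.
  by clear -K_gt0; nia.
- rewrite card_sum -/n addnn -mul2n; exact: n2m.
have KX : K * #|X| * (4 * B) <= n.
  apply: leq_trans mn; rewrite PE; move: (#|X|) Xs => x; clear -K_gt0 B_gt0 => Xs.
  apply: leq_trans (_ : K * (12 * (2 * B) * m) * (4 * B) <= _).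
    by rewrite leq_mul2r leq_mul2l Xs !orbT.
  by clear; nia.
have aB : 8 * (B * a) <= n.
  apply: leq_trans Na; rewrite -!mulnA leq_mul2l /=.
  apply: leq_trans (_ : P * a <= _); last by rewrite leq_pmull.
  rewrite leq_mul2r (leq_trans _ BP) ?orbT //; clear; lia.
have am : 4 * (k * a) < m.
  rewrite -(ltn_pmul2r P_gt0) ltnNge; apply/negP => mk.
  have : m.+1 * P <= 2 * (m * P) by rewrite mulSn mul2n -addnn leq_add2r leq_pmull.
  by clear -mk nm Na; move: (m * P) (m.+1 * P) mk nm; lia.
have fin : K * #|X| + 2 * a + 4 * s < th.
  rewrite -(ltn_pmul2r (_ : 0 < 4 * B)) ?muln_gt0 //.
  move: (K * #|X|) KX => x KX; clear -KX aB nBs nth nB; nia.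
apply: (@almost_tiling_of_classes G k c a (th - a - 4 * s) s th m X cl k_gt0 rich) => //.
- apply: leq_trans Ic; apply: subset_leq_card; apply/subsetP=> _ /imsetP[u _ ->].
  exact: clI.
- move=> u v /clL uv W Ww.
  have [||S [dS sS eS]] := @linked_exchanger G k a th th c.+2 u v W k_gt0 rich uv.
  + by rewrite -sE; clear -Ww fin; lia.
  + by rewrite -sE; clear -Ww fin; lia.
  by exists S; split=> //; rewrite sE; apply: ltnW.
- by move=> u; apply: FX (inl u).
- by move=> u; apply: FX (inr u).
- have : a <= k * a by rewrite leq_pmull.
  by clear -am; lia.
- move: fin; rewrite KE mulnDl mul1n; move: (#|X|) => x; clear; nia.
- move: fin; rewrite KE mulnDl mul1n; move: (#|X|) => x; clear; nia.
Qed.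

(** * From clique tilings to the statement *)

Lemma clique_rich_alpha (G : sgraph) k : clique_rich G k (alpha_ k G).
Proof.
move=> U aU; have [/existsP[f /andP[/injectiveP finj /forallP fadj]]|noU] :=
    boolP (contains_copy (complete k) (induced U)); last first.
  move: aU; rewrite ltnNge => /negP[].
  exact: (@leq_bigmax_cond _ _ (fun U : {set G} => #|U|) U noU).
exists [set val (f i) | i : complete k].
  by apply/subsetP=> _ /imsetP[i _ ->]; apply: (valP (f i)).
apply/kcliqueP; split.
  by rewrite card_imset ?card_ord // => i j /val_inj/finj.
move=> _ _ /imsetP[i _ ->] /imsetP[j _ ->] ij.
have /forallP/(_ j)/implyP := fadj i; apply.
by rewrite /= /complete_adj; apply: contraNneq ij => ->.
Qed.

Lemma min_degree_leq (G : sgraph) (v : G) : min_degree G <= #|nbhd v|.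
Proof.
rewrite /min_degree; have := mem_index_enum v; elim: (index_enum _) => // w s IHs.
rewrite inE big_cons => /predU1P[<-|/IHs]; first exact: geq_minl.
exact/leq_trans/geq_minr.
Qed.

(** Any bijection from [F] onto a clique preserves edges, so a clique tiling serves every [F] with
    as many vertices. *)
Lemma clique_copy (F G : sgraph) (K : {set G}) : kclique #|F| K ->
  exists f : {ffun F -> G}, is_copy f /\ copy_vertices f = K.
Proof.
case/kcliqueP=> Kk adjK.
pose f := [ffun x : F => enum_val (cast_ord (esym Kk) (enum_rank x))].
have finj : injective f.
  by move=> x y; rewrite !ffunE => /enum_val_inj/cast_ord_inj/enum_rank_inj.
have fK x : f x \in K by rewrite ffunE enum_valP.
exists f; split.
  apply/andP; split; first exact/injectiveP.
  apply/forallP => x; apply/forallP => y; apply/implyP => xy.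
  apply: adjK => //; apply: contraTneq xy => /finj->.
  by rewrite adj_irr.
apply/eqP; rewrite eqEcard card_imset // Kk leqnn andbT.
by apply/subsetP=> _ /imsetP[x _ ->].
Qed.

Lemma tileable_tiling (F G : sgraph) (A : {set G}) : tileable #|F| A ->
  exists P : {set {ffun F -> G}}, is_tiling P /\ covered P = A.
Proof.
elim=> [|K A' cK dKA _ [P [[Pcopy Pdis] PA]]].
  by exists set0; rewrite /covered big_set0; split=> //; split=> f; rewrite inE.
have [f [fcopy fK]] := clique_copy cK.
have dfP g : g \in P -> [disjoint copy_vertices f & copy_vertices g].
  by rewrite fK => gP; apply: disjointWr dKA; rewrite -PA; apply: bigcup_sup.
exists (f |: P); split; last by rewrite /covered bigcup_setU big_set1 fK -PA.
split=> [g /setU1P[->|/Pcopy]|g h /setU1P[->|gP] /setU1P[->|hP]] //.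
- by rewrite eqxx.
- by move=> _; apply: dfP.
- by move=> _; rewrite disjoint_sym; apply: dfP.
- exact: Pdis.
Qed.

Local Open Scope ring_scope.

Theorem theorem1p5 (R : realType) (k : nat) (eta : R)
    (hk : (3 <= k)%N) (eta_gt0 : 0 < eta) (eta_le1 : eta <= 1) :
  exists alpha : R, 0 < alpha /\
    exists n0 : nat, forall n : nat, (n0 <= n)%N ->
      forall G : sgraph, #|G| = n ->
        eta * n%:R <= (min_degree G)%:R ->
        (alpha_ k G)%:R <= alpha * n%:R ->
        has_quasiperfect_tiling eta (complete k) G /\
        (forall F : sgraph, #|F| = k -> has_quasiperfect_tiling eta F G).
Proof.
have k_gt0 : (0 < k)%N by apply: leq_trans hk.
have eta1 : 1 <= 1 / eta by rewrite ler_pdivlMr // mul1r.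
have [c cE] : exists c : nat, Num.floor (1 / eta) = c%:Z.
  exists `|Num.floor (1 / eta)|%N; rewrite gez0_abs // floor_ge0.
  exact: le_trans eta1.
have c_gt0 : (0 < c)%N.
  by rewrite -ltz_nat -cE floor_gt0.
(* As [c] is the floor, [c.+1] exceeds 1 / eta strictly; [M] then turns the gap into the slack
   1/M. *)
have ceta : 1 < c.+1%:R * eta.
  rewrite -ltr_pdivrMr //; have := floorD1_gt (1 / eta).
  by rewrite cE intrD -natr1.
have [M M_gt0 HM] : exists2 M : nat, (0 < M)%N & 1 <= M%:R * (c.+1%:R * eta - 1).
  set x := _ - 1; have x_gt0 : 0 < x by rewrite subr_gt0.
  exists (Num.bound x^-1).+1 => //; rewrite -ler_pdivrMr // div1r -natr1.
  by rewrite ler_wpDr // ltW // archi_boundP // invr_ge0 ltW.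
have [N [n0 [N_gt0 main]]] := almost_tiling k_gt0 c_gt0 M_gt0.
exists N%:R^-1; split; first by rewrite invr_gt0 ltr0n.
exists n0 => n n0n G Gn degG alphaG.
have [|||||A tA Ac] := main G (min_degree G) (alpha_ k G).
- by rewrite Gn.
- exact: min_degree_leq.
- rewrite Gn -(ler_nat R) !natrM.
  apply: le_trans (_ : M%:R * (c.+1%:R * (eta * n%:R)) <= _); last first.
    by rewrite !ler_wpM2l.
  rewrite !mulrA ler_wpM2r // -natr1 -lerBrDl -mulrA.
  by move: HM; rewrite mulrBr mulr1.
- exact: clique_rich_alpha.
- rewrite Gn -(ler_nat R) natrM; move: alphaG.
  by rewrite ler_pdivlMl ?ltr0n.
have tiling (F : sgraph) : #|F| = k -> has_quasiperfect_tiling eta F G.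
  move=> Fk; move: tA; rewrite -Fk => /tileable_tiling[P [tP PA]].
  exists P; split=> //; rewrite PA cE Fk.
  have -> : k%:Z - 1 = k.-1%:Z by clear -k_gt0; lia.
  by rewrite -PoszM lez_nat.
split=> //; apply: tiling; exact: card_ord.
Qed.
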